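(* Let $\mathbb{F}$ be a field, $\Gamma$ an arbitrary digraph and $L(\Gamma)=L_{\mathbb{F}}(\Gamma)$. The following are equivalent for an $L(\Gamma)$-module $M$: (i) $M$ is simple and projective; (ii) $M\cong vL(\Gamma)$ where $v$ is a sink or a leak; (iii) $M$ is simple and its support $V_M$ contains a sink or a leak; (iv) $M$ is finitely generated projective and $\mathrm{End}^{L(\Gamma)}(M)\cong\mathbb{F}$ (as $\mathbb{F}$-algebras). If $M$ satisfies any of these equivalent conditions then $V_M$ contains either a unique sink or a unique equivalence class of leaks. This gives a one-to-one correspondence between the set of isomorphism classes of simple projective $L(\Gamma)$-modules and the union of the set of sinks and the set of equivalence classes of leaks of $\Gamma$.
   Context: A digraph $\Gamma=(V,E,s,t)$ consists of arbitrary (possibly infinite) sets $V$ of vertices and $E$ of arrows and functions $s,t:E\to V$ (source, target). The Leavitt path algebra $L(\Gamma)=L_{\mathbb{F}}(\Gamma)$ is the (not necessarily unital) $\mathbb{F}$-algebra generated by $V\sqcup E\sqcup\{e^*: e\in E\}$ subject to: $uv=\delta_{u,v}u$ for $u,v\in V$; $s(e)e=e=e\,t(e)$ and $t(e)e^*=e^*=e^*s(e)$ for $e\in E$; (CK1) $e^*f=\delta_{e,f}t(e)$; (CK2) $v=\sum_{s(e)=v}ee^*$ for every $v$ with $0<|s^{-1}(v)|<\infty$. Modules are unital right modules ($M=ML(\Gamma)$). The support of a module $M$ is $V_M=\{v\in V: Mv\neq0\}$. A path of length $n>0$ is a sequence of arrows $e_1\cdots e_n$ with $t(e_i)=s(e_{i+1})$,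 with source $s(e_1)$ and target $t(e_n)$; a path of length $0$ is a vertex $v$, with $s(v)=t(v)=v$. A sink is a vertex $v$ with $s^{-1}(v)=\emptyset$. A leak is a vertex $v$ such that for every $n\in\mathbb{N}$ (including $0$) there is exactly one path $p_n$ of length $n$ with $s(p_n)=v$, and $t(p_m)\neq t(p_n)$ for all $m\neq n$. Two leaks $u,v$ are equivalent if they have a common successor, i.e. there is a vertex $w$ with a path from $u$ to $w$ and a path from $v$ to $w$. *)

(* Defs.v *)
From HB Require Import structures.
From mathcomp Require Import all_boot all_order all_algebra.
From mathcomp Require Import boolp classical_sets functions.

Set Implicit Arguments.
Unset Strict Implicit.
Unset Printing Implicit Defensive.

Import GRing.Theory.

Local Open Scope ring_scope.
Local Open Scope classical_set_scope.

Reserved Notation "a ⋅ b" (at level 40, left associativity).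
Reserved Notation "m ◃ a" (at level 40, left associativity).

(* Associative algebras over F that need not have a unit; MathComp's own      *)
(* algebra structures all contain a unit different from 0.                    *)
HB.mixin Record Lmodule_isAssocAlgebra (F : fieldType) A of GRing.Lmodule F A :=
{
  amul : A -> A -> A;
  amulA : associative amul;
  amulDl : left_distributive amul +%R;
  amulDr : right_distributive amul +%R;
  amulZl : forall (k : F) (a b : A), amul (k *: a) b = k *: amul a b;
  amulZr : forall (k : F) (a b : A), amul a (k *: b) = k *: amul a b
}.

#[short(type="assocAlgType")]
HB.structure Definition AssocAlgebra (F : fieldType) :=
  {A of Lmodule_isAssocAlgebra F A & GRing.Lmodule F A}.

Notation "a ⋅ b" := (amul a b) : ring_scope.

(* For algebras with a unit (such as F and the endomorphism algebras below) a *)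
(* multiplicative bijection automatically preserves the unit.                 *)
Definition alg_isomorphic (F : fieldType) (A B : assocAlgType F) : Prop :=
  exists f : A -> B,
    [/\ linear f, {morph f : a b / a ⋅ b} & bijective f].

Section BaseFieldAlgebra.
Variable F : fieldType.

Let regular_mulZr (k : F) (a b : F^o) :
  (a : F) * (k *: b : F^o) = k *: ((a : F) * (b : F) : F^o).
Proof. exact: mulrCA. Qed.

Let regular_mulZl (k : F) (a b : F^o) :
  (k *: a : F^o) * (b : F) = k *: ((a : F) * (b : F) : F^o).
Proof. by rewrite /GRing.scale /= mulrA. Qed.

HB.instance Definition _ := Lmodule_isAssocAlgebra.Build F F^o
  (@mulrA F) (@mulrDl F) (@mulrDr F) regular_mulZl regular_mulZr.
End BaseFieldAlgebra.

(* The last field says M = MA. *)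
HB.mixin Record Lmodule_isRightModule (F : fieldType) (A : assocAlgType F) M
    of GRing.Lmodule F M :=
{
  act : M -> A -> M;
  actA : forall (m : M) (a b : A), act (act m a) b = act m (a ⋅ b);
  actDl : forall (m n : M) (a : A), act (m + n) a = act m a + act n a;
  actDr : forall (m : M) (a b : A), act m (a + b) = act m a + act m b;
  actZl : forall (k : F) (m : M) (a : A), act (k *: m) a = k *: act m a;
  actZr : forall (k : F) (m : M) (a : A), act m (k *: a) = k *: act m a;
  act_unital : forall m : M, exists r : seq (M * A),
    m = \sum_(p <- r) act p.1 p.2
}.

#[short(type="rightModType")]
HB.structure Definition RightModule (F : fieldType) (A : assocAlgType F) :=
  {M of Lmodule_isRightModule F A M & GRing.Lmodule F M}.

Notation "m ◃ a" := (act m a) : ring_scope.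

Section Modules.
Variables (F : fieldType) (A : assocAlgType F).
Implicit Types M N P : rightModType A.

Definition module_hom M N (f : M -> N) : Prop :=
  linear f /\ forall (m : M) (a : A), f (m ◃ a) = f m ◃ a.

Definition mod_isomorphic M N : Prop :=
  exists f : M -> N, module_hom f /\ bijective f.

Definition submodule M (S : set M) : Prop :=
  [/\ S 0,
      forall x y, S x -> S y -> S (x + y),
      forall (k : F) x, S x -> S (k *: x)
    & forall x (a : A), S x -> S (x ◃ a)].

Definition simple M : Prop :=
  [set: M] <> [set 0] /\
  forall S : set M, submodule S -> S = [set 0] \/ S = [set: M].

Definition finitely_generated M : Prop :=
  exists r : seq M,
    forall S : set M, submodule S -> (forall x, x \in r -> S x) -> S = [set: M].

Definition projective M : Prop :=
  forall (N P : rightModType A) (g : N -> P) (f : M -> P),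
    module_hom g -> set_surj [set: N] [set: P] g -> module_hom f ->
    exists2 h : M -> N, module_hom h & f = g \o h.

End Modules.

Section EndomorphismAlgebra.
Variables (F : fieldType) (A : assocAlgType F) (M : rightModType A).

Definition endo_pred : {pred M -> M} := fun f => `[< module_hom f >].

Record endo := Endo { endo_fun :> M -> M; endoP : endo_fun \in endo_pred }.

HB.instance Definition _ := [isSub for endo_fun].
HB.instance Definition _ := [Choice of endo by <:].

Lemma endo_hom (f : endo) : module_hom f.
Proof. exact: asboolW (endoP f). Qed.

Let endo_submod_closed : submod_closed endo_pred.
Proof.
split.
  have E (z : M) : (0 : M -> M) z = 0 by [].
  apply/asboolP; split=> [k x y|m a]; rewrite !E ?scaler0 ?addr0 //.
  by have := actZl (0 : F) (0 : M) a; rewrite !scale0r.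
move=> k f g /asboolP[fL fA] /asboolP[gL gA]; apply/asboolP.
have E (z : M) : (k *: f + g) z = k *: f z + g z by [].
split=> [c x y|m a]; rewrite !E.
  rewrite fL gL !scalerDr !scalerA (mulrC k c) -!addrA; congr (_ + _).
  by rewrite addrCA.
by rewrite fA gA actDl actZl.
Qed.

HB.instance Definition _ := GRing.isSubmodClosed.Build F (M -> M) endo_pred
  endo_submod_closed.
HB.instance Definition _ := [SubChoice_isSubLmodule of endo by <:].

Let endo_comp_subproof (f g : endo) : f \o g \in endo_pred.
Proof.
have [[fL fA] [gL gA]] := (endo_hom f, endo_hom g).
by apply/asboolP; split=> [c x y|m a]; rewrite /= ?gL ?gA ?fL ?fA.
Qed.

Definition endo_comp (f g : endo) : endo := Endo (endo_comp_subproof f g).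

Let endo_compA : associative endo_comp.
Proof. by move=> f g h; apply: val_inj. Qed.

Let endo_compDl : left_distributive endo_comp +%R.
Proof. by move=> f g h; apply: val_inj. Qed.

Let endo_compDr : right_distributive endo_comp +%R.
Proof.
move=> f g h; apply: val_inj; apply/funext=> x /=.
by have [fL _] := endo_hom f; have := fL 1 (g x) (h x); rewrite !scale1r.
Qed.

Let endo_compZl (k : F) (f g : endo) :
  endo_comp (k *: f) g = k *: endo_comp f g.
Proof. exact: val_inj. Qed.

Let endo_compZr (k : F) (f g : endo) :
  endo_comp f (k *: g) = k *: endo_comp f g.
Proof.
apply: val_inj; apply/funext=> x /=.
have [fL _] := endo_hom f.
have f0 : f 0 = 0 by have := fL (-1) 0 0; rewrite !scaleN1r !addNr.
by have := fL k (g x) 0; rewrite f0 !addr0.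
Qed.

HB.instance Definition _ := Lmodule_isAssocAlgebra.Build F endo
  endo_compA endo_compDl endo_compDr endo_compZl endo_compZr.

End EndomorphismAlgebra.

(* The algebra (without unit) generated by X subject to the relations R:      *)
(* formal expressions in X modulo the least congruence that contains R and    *)
(* the algebra axioms.                                                        *)
Section Presentation.
Variables (F : fieldType) (X : Type).

Inductive term :=
  | Gen of X
  | Zero
  | Opp of term
  | Add of term & term
  | Scale of F & term
  | Mul of term & term.

HB.instance Definition _ := gen_eqMixin term.
HB.instance Definition _ := gen_choiceMixin term.

Variable R : term -> term -> Prop.

Inductive cong : term -> term -> Prop :=
  | cong_rel a b : R a b -> cong a b
  | cong_refl a : cong a a
  | cong_sym a b : cong a b -> cong b a
  | cong_trans b a c : cong a b -> cong b c -> cong a c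
  | cong_Opp a a' : cong a a' -> cong (Opp a) (Opp a')
  | cong_Add a a' b b' : cong a a' -> cong b b' -> cong (Add a b) (Add a' b')
  | cong_Scale k a a' : cong a a' -> cong (Scale k a) (Scale k a')
  | cong_Mul a a' b b' : cong a a' -> cong b b' -> cong (Mul a b) (Mul a' b')
  | cong_addA a b c : cong (Add a (Add b c)) (Add (Add a b) c)
  | cong_addC a b : cong (Add a b) (Add b a)
  | cong_add0 a : cong (Add Zero a) a
  | cong_addN a : cong (Add (Opp a) a) Zero
  | cong_scaleA k l a : cong (Scale k (Scale l a)) (Scale (k * l) a)
  | cong_scale1 a : cong (Scale 1 a) a
  | cong_scaleDr k a b : cong (Scale k (Add a b)) (Add (Scale k a) (Scale k b))
  | cong_scaleDl k l a : cong (Scale (k + l) a) (Add (Scale k a) (Scale l a))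
  | cong_mulA a b c : cong (Mul a (Mul b c)) (Mul (Mul a b) c)
  | cong_mulDl a b c : cong (Mul (Add a b) c) (Add (Mul a c) (Mul b c))
  | cong_mulDr a b c : cong (Mul a (Add b c)) (Add (Mul a b) (Mul a c))
  | cong_mulZl k a b : cong (Mul (Scale k a) b) (Scale k (Mul a b))
  | cong_mulZr k a b : cong (Mul a (Scale k b)) (Scale k (Mul a b)).

Definition congb : rel term := fun a b => `[< cong a b >].

Let congb_refl : reflexive congb.
Proof. by move=> a; apply/asboolP/cong_refl. Qed.

Let congb_sym : symmetric congb.
Proof. by move=> a b; apply/asboolP/asboolP => /cong_sym. Qed.

Let congb_trans : transitive congb.
Proof.
by move=> b a c /asboolP ab /asboolP bc; apply/asboolP/(cong_trans ab bc).
Qed.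

Canonical cong_equiv := EquivRel congb congb_refl congb_sym congb_trans.

Definition presented := {eq_quot cong_equiv}%qT.

HB.instance Definition _ := Choice.on presented.

Definition class_of (a : term) : presented := (\pi_({eq_quot cong_equiv}) a)%qT.

Lemma class_ofP a b : class_of a = class_of b <-> cong a b.
Proof. by split=> [/eqmodP/asboolP|ab]; [|apply/eqmodP/asboolP]. Qed.

Let rep (x : presented) : term := (repr (x : {eq_quot cong_equiv}))%qT.

Let repK x : class_of (rep x) = x.
Proof. exact: reprK. Qed.

Let cong_rep a : cong (rep (class_of a)) a.
Proof. by apply/class_ofP; rewrite repK. Qed.

Definition popp x := class_of (Opp (rep x)).
Definition padd x y := class_of (Add (rep x) (rep y)).
Definition pscale k x := class_of (Scale k (rep x)).
Definition pmul x y := class_of (Mul (rep x) (rep y)).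

Lemma class_ofN a : popp (class_of a) = class_of (Opp a).
Proof. exact/class_ofP/cong_Opp/cong_rep. Qed.

Lemma class_ofD a b : padd (class_of a) (class_of b) = class_of (Add a b).
Proof. by apply/class_ofP/cong_Add; apply: cong_rep. Qed.

Lemma class_ofZ k a : pscale k (class_of a) = class_of (Scale k a).
Proof. exact/class_ofP/cong_Scale/cong_rep. Qed.

Lemma class_ofM a b : pmul (class_of a) (class_of b) = class_of (Mul a b).
Proof. by apply/class_ofP/cong_Mul; apply: cong_rep. Qed.

Let classE := (class_ofN, class_ofD, class_ofZ, class_ofM).

Let paddA : associative padd.
Proof.
move=> x y z; rewrite -(repK x) -(repK y) -(repK z) !classE.
exact/class_ofP/cong_addA.
Qed.

Let paddC : commutative padd.
Proof.
by move=> x y; rewrite -(repK x) -(repK y) !classE; apply/class_ofP/cong_addC.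
Qed.

Let padd0 : left_id (class_of Zero) padd.
Proof. by move=> x; rewrite -(repK x) !classE; apply/class_ofP/cong_add0. Qed.

Let paddN : left_inverse (class_of Zero) popp padd.
Proof. by move=> x; rewrite -(repK x) !classE; apply/class_ofP/cong_addN. Qed.

HB.instance Definition _ :=
  GRing.isZmodule.Build presented paddA paddC padd0 paddN.

Let pscaleA k l x : pscale k (pscale l x) = pscale (k * l) x.
Proof. by rewrite -(repK x) !classE; apply/class_ofP/cong_scaleA. Qed.

Let pscale1 : left_id 1 pscale.
Proof. by move=> x; rewrite -(repK x) !classE; apply/class_ofP/cong_scale1. Qed.

Let pscaleDr : right_distributive pscale +%R.
Proof.
move=> k x y; rewrite -(repK x) -(repK y) /GRing.add /= !classE.
exact/class_ofP/cong_scaleDr.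
Qed.

Let pscaleDl x : {morph pscale^~ x : k l / k + l}.
Proof.
move=> k l; rewrite -(repK x) [RHS]/GRing.add /= !classE.
exact/class_ofP/cong_scaleDl.
Qed.

HB.instance Definition _ := GRing.Zmodule_isLmodule.Build F presented
  pscaleA pscale1 pscaleDr pscaleDl.

Let pmulA : associative pmul.
Proof.
move=> x y z; rewrite -(repK x) -(repK y) -(repK z) !classE.
exact/class_ofP/cong_mulA.
Qed.

Let pmulDl : left_distributive pmul +%R.
Proof.
move=> x y z; rewrite -(repK x) -(repK y) -(repK z) /GRing.add /= !classE.
exact/class_ofP/cong_mulDl.
Qed.

Let pmulDr : right_distributive pmul +%R.
Proof.
move=> x y z; rewrite -(repK x) -(repK y) -(repK z) /GRing.add /= !classE.
exact/class_ofP/cong_mulDr.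
Qed.

Let pmulZl k x y : pmul (k *: x) y = k *: pmul x y.
Proof.
rewrite -(repK x) -(repK y) /GRing.scale /= !classE.
exact/class_ofP/cong_mulZl.
Qed.

Let pmulZr k x y : pmul x (k *: y) = k *: pmul x y.
Proof.
rewrite -(repK x) -(repK y) /GRing.scale /= !classE.
exact/class_ofP/cong_mulZr.
Qed.

HB.instance Definition _ := Lmodule_isAssocAlgebra.Build F presented
  pmulA pmulDl pmulDr pmulZl pmulZr.

End Presentation.

Arguments Zero {F X}.

Record digraph := Digraph {
  vertex : Type;
  arrow : Type;
  source : arrow -> vertex;
  target : arrow -> vertex
}.

Arguments source {d}.
Arguments target {d}.

HB.instance Definition _ (G : digraph) := gen_eqMixin (arrow G).
HB.instance Definition _ (G : digraph) := gen_choiceMixin (arrow G).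

Section DigraphNotions.
Variable G : digraph.
Implicit Types (u v w : vertex G) (p : seq (arrow G)).

(* A path with source v is encoded by v and the sequence of its arrows, so    *)
(* that the path of length 0 at v is v with the empty sequence.               *)
Fixpoint is_path v p : Prop :=
  if p is e :: p' then source e = v /\ is_path (target e) p' else True.

Definition path_target v p : vertex G := last v (map target p).

Definition sink v : Prop := forall e : arrow G, source e <> v.

Definition leak v : Prop :=
  exists p : nat -> seq (arrow G),
    (forall n, [/\ is_path v (p n), size (p n) = n
       & forall q, is_path v q -> size q = n -> q = p n]) /\
    (forall m n, m <> n -> path_target v (p m) <> path_target v (p n)).

Definition has_path u w : Prop := exists2 p, is_path u p & path_target u p = w.

Definition leak_equiv u v : Prop := exists2 w, has_path u w & has_path v w.

Definition leak_class (C : set (vertex G)) : Prop :=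
  exists2 v, leak v & C = [set u | leak u /\ leak_equiv u v].

(* Disjoint union of the set of sinks and the set of equivalence classes of   *)
(* leaks.                                                                     *)
Definition sinks_and_leak_classes : set (vertex G + set (vertex G)) :=
  inl @` [set v | sink v] `|` inr @` [set C | leak_class C].

End DigraphNotions.

Section LeavittPathAlgebra.
Variables (F : fieldType) (G : digraph).

Inductive lpa_gen :=
  | Vertex of vertex G
  | Arrow of arrow G
  | Ghost of arrow G.

Notation "'v_ u" := (Gen F (Vertex u)) (at level 8, u at level 2).
Notation "'a_ e" := (Gen F (Arrow e)) (at level 8, e at level 2).
Notation "'g_ e" := (Gen F (Ghost e)) (at level 8, e at level 2).

(* In the last relation l lists s^-1(v) without repetition; such an l exists  *)
(* if and only if s^-1(v) is finite.                                          *)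
Inductive lpa_rel : term F lpa_gen -> term F lpa_gen -> Prop :=
  | rel_VV u : lpa_rel (Mul 'v_u 'v_u) 'v_u
  | rel_VV0 u v : u <> v -> lpa_rel (Mul 'v_u 'v_v) Zero
  | rel_sA e : lpa_rel (Mul 'v_(source e) 'a_e) 'a_e
  | rel_At e : lpa_rel (Mul 'a_e 'v_(target e)) 'a_e
  | rel_tG e : lpa_rel (Mul 'v_(target e) 'g_e) 'g_e
  | rel_Gs e : lpa_rel (Mul 'g_e 'v_(source e)) 'g_e
  | rel_CK1 e : lpa_rel (Mul 'g_e 'a_e) 'v_(target e)
  | rel_CK10 e f : e <> f -> lpa_rel (Mul 'g_e 'a_f) Zero
  | rel_CK2 v (l : seq (arrow G)) :
      l <> [::] -> uniq l -> (forall e, e \in l <-> source e = v) ->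
      lpa_rel 'v_v (\big[@Add F lpa_gen/Zero]_(e <- l) Mul 'a_e 'g_e).

Definition lpa : assocAlgType F := presented lpa_rel.

Definition lpa_vertex (v : vertex G) : lpa := class_of lpa_rel 'v_v.

Lemma lpa_vertex_idem v : lpa_vertex v ⋅ lpa_vertex v = lpa_vertex v.
Proof.
by rewrite /lpa_vertex /amul /= class_ofM; apply/class_ofP/cong_rel/rel_VV.
Qed.

Definition module_support (M : rightModType lpa) : set (vertex G) :=
  [set v | exists m : M, m ◃ lpa_vertex v <> 0].

Section VertexModule.
Variable v : vertex G.

Definition vL_pred : {pred lpa} :=
  fun x => `[< exists a : lpa, x = lpa_vertex v ⋅ a >].

Record vL := VL { vL_val :> lpa; vLP : vL_val \in vL_pred }.

HB.instance Definition _ := [isSub for vL_val].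
HB.instance Definition _ := [Choice of vL by <:].

Let vL_submod_closed : submod_closed vL_pred.
Proof.
split=> [|k _ _ /asboolP[a ->] /asboolP[b ->]]; apply/asboolP.
  exists 0; have := amulZr (0 : F) (lpa_vertex v) (0 : lpa).
  by rewrite !scale0r.
by exists (k *: a + b); rewrite amulDr amulZr.
Qed.

HB.instance Definition _ := GRing.isSubmodClosed.Build F lpa vL_pred
  vL_submod_closed.
HB.instance Definition _ := [SubChoice_isSubLmodule of vL by <:].

Let vL_act_subproof (x : vL) (a : lpa) : vL_val x ⋅ a \in vL_pred.
Proof.
by have /asboolP[b ->] := vLP x; apply/asboolP; exists (b ⋅ a); rewrite amulA.
Qed.

Definition vL_act (x : vL) (a : lpa) : vL := VL (vL_act_subproof x a).

Let vL_actA x a b : vL_act (vL_act x a) b = vL_act x (a ⋅ b).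
Proof. by apply: val_inj; rewrite /= amulA. Qed.

Let vL_actDl x y a : vL_act (x + y) a = vL_act x a + vL_act y a.
Proof. by apply: val_inj; rewrite /= amulDl. Qed.

Let vL_actDr x a b : vL_act x (a + b) = vL_act x a + vL_act x b.
Proof. by apply: val_inj; rewrite /= amulDr. Qed.

Let vL_actZl k x a : vL_act (k *: x) a = k *: vL_act x a.
Proof. by apply: val_inj; rewrite /= amulZl. Qed.

Let vL_actZr k x a : vL_act x (k *: a) = k *: vL_act x a.
Proof. by apply: val_inj; rewrite /= amulZr. Qed.

Let vL_unital (x : vL) : exists r : seq (vL * lpa),
  x = \sum_(p <- r) vL_act p.1 p.2.
Proof.
have vP : lpa_vertex v \in vL_pred.
  by apply/asboolP; exists (lpa_vertex v); rewrite lpa_vertex_idem.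
have /asboolP[a xE] := vLP x.
by exists [:: (VL vP, a)]; rewrite big_seq1; apply: val_inj.
Qed.

HB.instance Definition _ := Lmodule_isRightModule.Build F lpa vL
  vL_actA vL_actDl vL_actDr vL_actZl vL_actZr vL_unital.

End VertexModule.

(* Collections of modules are plain predicates here, and one_to_one_on below  *)
(* restates set_bij for predicates: rightModType lpa is too large a type for  *)
(* the universe at which set is declared.                                     *)
Definition iso_class (M : rightModType lpa) : rightModType lpa -> Prop :=
  fun N => mod_isomorphic N M.

Definition simple_projective_class (C : rightModType lpa -> Prop) : Prop :=
  exists M : rightModType lpa, [/\ simple M, projective M & C = iso_class M].

End LeavittPathAlgebra.

Arguments vL F {G}.

Definition one_to_one_on (T U : Type) (P : T -> Prop) (Q : U -> Prop)
    (f : T -> U) : Prop :=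
  [/\ forall x, P x -> Q (f x),
      forall x y, P x -> P y -> f x = f y -> x = y
    & forall y, Q y -> exists2 x, P x & f x = y].

(* Main.v *)
From HB Require Import structures.
From mathcomp Require Import all_boot all_order all_algebra.
From mathcomp Require Import boolp classical_sets functions.
Require Import Defs.

(* L(G) acts on functions on the set of maximal paths, with an indeterminate  *)
(* recording degrees; hence vertices are nonzero, and the corner of L(G) at a *)
(* vertex on a cycle without exit maps onto the Laurent polynomials. The      *)
(* reduction theorem says that a nonzero x in L(G) can be turned by left and  *)
(* right multiplication into a vertex, or into an element with nonzero        *)
(* Laurent polynomial on a cycle without exit. Let M be finitely generated    *)
(* projective and suppose that each of its nonzero endomorphisms is bijective *)
(* (Schur if M is simple; clear if End M = F). M embeds in a free module, and *)
(* reducing a nonzero coordinate splits some wL(G) off M, so that M = wL(G):  *)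
(* the cycle case would make a non-unit Laurent polynomial invertible. In the *)
(* same way, w reaches neither a branching nor a cycle, so w is a leak or     *)
(* reaches a sink v, in which case wL(G) = vL(G). Conversely, if v is a sink  *)
(* or a leak, (CK2) gives p p^* = v for all paths p from v, from which vL(G)  *)
(* is seen to be simple with v L(G) v = F v.                                  *)

Set Implicit Arguments.
Unset Strict Implicit.
Unset Printing Implicit Defensive.

Import GRing.Theory.

Local Open Scope ring_scope.

(** The first bridge is the class of [schurian] modules, whose nonzero endomorphisms are bijective.
    Simple modules belong to it by Schur's lemma, and so do those with End M = F, so
    [schurian_sink_or_leak] serves both (i) and (iv). If such an M is finitely generated projective
    and m <> 0, [projective_coordinate] gives g : M -> L with g m <> 0. By [reduction] some a (g m)
    b is a vertex w or has a nonzero Laurent polynomial at a cycle without exit.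
    [schurian_rigid_cycle] excludes the latter; in the former case wL is a direct summand, and the
    projection onto it, a nonzero endomorphism, is bijective, so M = wL ([schurian_vL]).

    The second is the notion of a [tame] vertex, from which neither a branching nor a closed path
    can be reached. The vertex w is tame by [schurian_vL_tame], and by [tame_sink_or_leak] it leads
    to a sink or leak v, with vL isomorphic to wL ([nobranch_iso]). Conversely, at a tame v the
    relation (CK2) gives p p^* = v along every path, so each element of vL is p y with y a
    combination of ghost paths ([nobranch_corner_form]). Hence vL is simple with scalar
    endomorphisms ([tame_simple], [tame_endo]). A simple module whose support contains a tame v is
    isomorphic to vL ([simple_support_iso]), and for tame u and v the modules uL and vL are
    isomorphic exactly when u and v have a common successor ([leak_equiv_iso]); the classification
    follows. *)

HB.instance Definition _ (G : digraph) := gen_eqMixin (vertex G).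
HB.instance Definition _ (G : digraph) := gen_choiceMixin (vertex G).

(** * Algebras without unit and linear combinations *)

Section AssocAlgebraTheory.
Variables (F : fieldType) (A : assocAlgType F).
Implicit Types a b c : A.

Lemma amul0l a : 0 ⋅ a = 0.
Proof. by have := amulZl (0 : F) (0 : A) a; rewrite !scale0r. Qed.

Lemma amul0r a : a ⋅ 0 = 0.
Proof. by have := amulZr (0 : F) a (0 : A); rewrite !scale0r. Qed.

Lemma amulNl a b : (- a) ⋅ b = - (a ⋅ b).
Proof. by rewrite -!scaleN1r amulZl. Qed.

Lemma amulNr a b : a ⋅ (- b) = - (a ⋅ b).
Proof. by rewrite -!scaleN1r amulZr. Qed.

Lemma amulBl a b c : (a - b) ⋅ c = a ⋅ c - b ⋅ c.
Proof. by rewrite amulDl amulNl. Qed.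

Lemma amulBr a b c : c ⋅ (a - b) = c ⋅ a - c ⋅ b.
Proof. by rewrite amulDr amulNr. Qed.

Lemma amul_suml I (r : seq I) (P : pred I) (f : I -> A) a :
  (\sum_(i <- r | P i) f i) ⋅ a = \sum_(i <- r | P i) f i ⋅ a.
Proof.
by apply: (big_morph (fun x => x ⋅ a)) => [x y|]; rewrite ?amulDl ?amul0l.
Qed.

Lemma amul_sumr I (r : seq I) (P : pred I) (f : I -> A) a :
  a ⋅ (\sum_(i <- r | P i) f i) = \sum_(i <- r | P i) a ⋅ f i.
Proof. by apply: big_morph => [x y|]; rewrite ?amulDr ?amul0r. Qed.

Lemma linear_amull a : linear (amul a).
Proof. by move=> k x y; rewrite amulDr amulZr. Qed.

Lemma linear_amulr a : linear (fun x => x ⋅ a).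
Proof. by move=> k x y; rewrite amulDl amulZl. Qed.

End AssocAlgebraTheory.

Section LinearCombinations.
Variable F : fieldType.

(** The span of the f t with Q t. The predicate Q carries the shape of normal forms and bounds on
    lengths. *)
Definition combo (V : lmodType F) (T : eqType) (f : T -> V) (Q : T -> Prop)
    (x : V) : Prop :=
  exists2 r : seq (F * T), (forall t, t \in r -> Q t.2) &
    x = \sum_(t <- r) t.1 *: f t.2.

Section OneFamily.
Variables (V : lmodType F) (T : eqType) (f : T -> V).
Implicit Types Q : T -> Prop.

Lemma combo0 Q : combo f Q 0.
Proof. by exists [::] => //; rewrite big_nil. Qed.

Lemma comboD Q x y : combo f Q x -> combo f Q y -> combo f Q (x + y).
Proof.
move=> [r rQ ->] [s sQ ->]; exists (r ++ s); last by rewrite big_cat.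
by move=> t; rewrite mem_cat => /orP[/rQ|/sQ].
Qed.

Lemma comboZ Q k x : combo f Q x -> combo f Q (k *: x).
Proof.
move=> [r rQ ->]; exists [seq (k * t.1, t.2) | t <- r].
  by move=> _ /mapP[t /rQ tQ ->].
by rewrite big_map scaler_sumr; apply: eq_bigr => t _; rewrite scalerA.
Qed.

Lemma combo1 Q t : Q t -> combo f Q (f t).
Proof.
move=> Qt; exists [:: (1, t)]; last by rewrite big_seq1 scale1r.
by move=> s; rewrite inE => /eqP->.
Qed.

Lemma combo_ind Q (R : V -> Prop) :
    R 0 -> (forall k t x, Q t -> R x -> R (k *: f t + x)) ->
  forall x, combo f Q x -> R x.
Proof.
move=> R0 RS x [r rQ ->]; elim: r rQ => [|t r IH] rQ; first by rewrite big_nil.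
rewrite big_cons; apply: RS; first by apply: rQ; rewrite mem_head.
by apply: IH => s sr; apply: rQ; rewrite inE sr orbT.
Qed.

Lemma combo_sub Q Q' x :
  (forall t, Q t -> Q' t) -> combo f Q x -> combo f Q' x.
Proof. by move=> QQ' [r rQ ->]; exists r => // t /rQ/QQ'. Qed.

Lemma combo_split Q (P : T -> bool) x : combo f Q x ->
  exists y z, [/\ x = y + z, combo f (fun t => Q t /\ P t) y
    & combo f (fun t => Q t /\ ~~ P t) z].
Proof.
elim/combo_ind => [|k t _ Qt [y [z [-> cy cz]]]].
  by exists 0, 0; split; rewrite ?addr0 //; apply: combo0.
have [Pt|Pt] := boolP (P t).
  exists (k *: f t + y), z; split; rewrite ?addrA //.
  by apply: comboD => //; apply: comboZ; apply: combo1.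
exists y, (k *: f t + z); split; rewrite ?addrA ?[_ + y]addrC ?addrA //.
by apply: comboD => //; apply: comboZ; apply: combo1.
Qed.

(** Equal terms are collected and zero coefficients dropped. *)
Lemma combo_uniq Q x : combo f Q x ->
  exists s (c : T -> F), [/\ uniq s, forall t, t \in s -> Q t /\ c t != 0
    & x = \sum_(t <- s) c t *: f t].
Proof.
elim/combo_ind => [|k t _ Qt [s [c [us cP ->]]]].
  by exists [::], (fun=> 0); split; rewrite ?big_nil.
(* The values of c outside s are arbitrary, hence the test [t \in s]. *)
pose c' u := if u == t then k + (if t \in s then c t else 0) else c u.
have eqc u : u != t -> c' u = c u by rewrite /c' => /negPf->.
have E : k *: f t + \sum_(u <- s) c u *: f u =
    c' t *: f t + \sum_(u <- s | u != t) c' u *: f u.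
  rewrite [in RHS](eq_bigr (fun u => c u *: f u));
    last by move=> u ut; rewrite eqc.
  rewrite {1}/c' eqxx; case: ifP => [ts|tNs].
    by rewrite (bigD1_seq t) //= scalerDl addrA.
  rewrite addr0; congr (_ + _); rewrite big_seq [RHS]big_seq_cond.
  apply: eq_bigl => u; have [us'|//] := boolP (u \in s).
  by apply/esym; apply: contraTneq us' => ->; rewrite tNs.
rewrite E; set s' := [seq u <- s | u != t].
have us' : uniq s' by rewrite filter_uniq.
have tNs' : t \notin s' by rewrite mem_filter eqxx.
have s'P u : u \in s' -> Q u /\ c' u != 0.
  by rewrite mem_filter => /andP[ut /cP]; rewrite eqc.
rewrite -big_filter -/s'; have [c0|c0] := eqVneq (c' t) 0.
  by exists s', c'; split; rewrite // c0 scale0r add0r.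
exists (t :: s'), c'; split; rewrite ?big_cons //= ?tNs' // => u.
by rewrite inE => /orP[/eqP->|/s'P].
Qed.

End OneFamily.

Lemma combo_map (V W : lmodType F) (T U : eqType) (f : T -> V) (f' : U -> W)
    (Q : T -> Prop) (Q' : U -> Prop) (g : V -> W) :
    linear g -> (forall t, Q t -> combo f' Q' (g (f t))) ->
  forall x, combo f Q x -> combo f' Q' (g x).
Proof.
move=> gL gQ; have g0 : g 0 = 0.
  by have := gL (-1) 0 0; rewrite !scaleN1r !addNr.
apply: combo_ind => [|k t x Qt gx]; first by rewrite g0; apply: combo0.
by rewrite gL; apply: comboD => //; apply: comboZ; apply: gQ.
Qed.

(** Each term is fixed by one of the eps i and killed by the others. Allowing every larger s' lets
    the local units of several elements be merged. *)
Lemma combo_local_unit (A : assocAlgType F) (T I : eqType) (f : T -> A)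
    (Q : T -> Prop) (h : T -> I) (eps : I -> A) :
    (forall t i, Q t -> f t ⋅ eps i = if i == h t then f t else 0) ->
  forall x, combo f Q x -> exists s : seq I,
    forall s', uniq s' -> {subset s <= s'} -> x ⋅ (\sum_(i <- s') eps i) = x.
Proof.
move=> H; apply: combo_ind => [|k t x Qt [s sP]].
  by exists [::] => s' _ _; rewrite amul0l.
exists (h t :: s) => s' us' ss'; rewrite amulDl amulZl sP //; last first.
  by move=> i si; apply: ss'; rewrite inE si orbT.
congr (_ *: _ + _); rewrite amul_sumr (bigD1_seq (h t)) //=; last first.
  by apply: ss'; rewrite mem_head.
rewrite H // eqxx big1 ?addr0 // => i /negPf iN.
by rewrite H // iN.
Qed.

End LinearCombinations.

(** * Paths and monomials in Leavitt path algebras *)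

Section Paths.
Variable G : digraph.
Implicit Types (u v w : vertex G) (p q : seq (arrow G)).

Lemma is_path_cat v p q :
  is_path v (p ++ q) <-> is_path v p /\ is_path (path_target v p) q.
Proof.
elim: p v => [|e p IH] v /=; first by split=> [|[]].
by rewrite IH -/(path_target _ p); split=> [[? []]|[[]]].
Qed.

Lemma path_target_cat v p q :
  path_target v (p ++ q) = path_target (path_target v p) q.
Proof. by rewrite /path_target map_cat last_cat. Qed.

Lemma is_path_rcons v p e :
  is_path v (rcons p e) <-> is_path v p /\ source e = path_target v p.
Proof. by rewrite -cats1 is_path_cat /=; split=> [[? []]|[]]. Qed.

Lemma path_target_rcons v p e : path_target v (rcons p e) = target e.
Proof. by rewrite -cats1 path_target_cat. Qed.

End Paths.

Section Monomials.
Variables (F : fieldType) (G : digraph).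
Local Notation L := (lpa F G).
Local Notation lv := (@lpa_vertex F G).
Implicit Types (u v w : vertex G) (p q : seq (arrow G)) (e f : arrow G).

Lemma class_ofDE (a b : term F (lpa_gen G)) :
  (class_of (@lpa_rel F G) (Add a b) : L) = (class_of _ a : L) + class_of _ b.
Proof. by rewrite -class_ofD. Qed.

Lemma class_ofME (a b : term F (lpa_gen G)) :
  (class_of (@lpa_rel F G) (Mul a b) : L) = (class_of _ a : L) ⋅ class_of _ b.
Proof. by rewrite -class_ofM. Qed.

Lemma class_ofZE k (a : term F (lpa_gen G)) :
  (class_of (@lpa_rel F G) (Scale k a) : L) = k *: (class_of _ a : L).
Proof. by rewrite -class_ofZ. Qed.

Lemma class_ofNE (a : term F (lpa_gen G)) :
  (class_of (@lpa_rel F G) (Opp a) : L) = - (class_of _ a : L).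
Proof. by rewrite -class_ofN. Qed.

Lemma class_of0E : (class_of (@lpa_rel F G) Zero : L) = 0.
Proof. by []. Qed.

Definition lpa_arrow e : L := class_of (@lpa_rel F G) (Gen F (Arrow e)).
Definition lpa_ghost e : L := class_of (@lpa_rel F G) (Gen F (Ghost e)).
Local Notation la := lpa_arrow.
Local Notation lg := lpa_ghost.

Lemma lpa_class_surj (x : L) : exists t, x = class_of (@lpa_rel F G) t.
Proof.
exists (repr (x : {eq_quot (cong_equiv (@lpa_rel F G))})%qT).
by rewrite /class_of reprK.
Qed.

Lemma lpa_relE a b : lpa_rel a b ->
  class_of (@lpa_rel F G) a = class_of (@lpa_rel F G) b.
Proof. by move=> ab; apply/class_ofP/cong_rel. Qed.

Lemma vertex_orth u v : u <> v -> lv u ⋅ lv v = 0.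
Proof. by move=> uv; rewrite -class_ofME (lpa_relE (rel_VV0 _ uv)). Qed.

Lemma source_arrow e : lv (source e) ⋅ la e = la e.
Proof. by rewrite -class_ofME (lpa_relE (rel_sA _ e)). Qed.

Lemma arrow_target e : la e ⋅ lv (target e) = la e.
Proof. by rewrite -class_ofME (lpa_relE (rel_At _ e)). Qed.

Lemma target_ghost e : lv (target e) ⋅ lg e = lg e.
Proof. by rewrite -class_ofME (lpa_relE (rel_tG _ e)). Qed.

Lemma ghost_source e : lg e ⋅ lv (source e) = lg e.
Proof. by rewrite -class_ofME (lpa_relE (rel_Gs _ e)). Qed.

Lemma ghost_arrow e : lg e ⋅ la e = lv (target e).
Proof. by rewrite -class_ofME (lpa_relE (rel_CK1 _ e)). Qed.

Lemma ghost_arrow0 e f : e <> f -> lg e ⋅ la f = 0.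
Proof. by move=> ef; rewrite -class_ofME (lpa_relE (rel_CK10 _ ef)). Qed.

Lemma vertex_CK2 v (s : seq (arrow G)) : s <> [::] -> uniq s ->
    (forall e, e \in s <-> source e = v) ->
  lv v = \sum_(e <- s) la e ⋅ lg e.
Proof.
move=> s0 us sP; rewrite /lpa_vertex (lpa_relE (rel_CK2 _ s0 us sP)).
rewrite (big_morph (fun t => class_of (@lpa_rel F G) t : L)
  class_ofDE class_of0E).
by apply: eq_bigr => e _; rewrite class_ofME.
Qed.

(** The path p as an element of L, and next its ghost p^*. The base vertex matters only when p is
    empty. *)
Fixpoint rpath v p : L :=
  if p is e :: p' then la e ⋅ rpath (target e) p' else lv v.

Fixpoint gpath v p : L :=
  if p is e :: p' then gpath (target e) p' ⋅ lg e else lv v.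

Lemma vertex_rpath v p : is_path v p -> lv v ⋅ rpath v p = rpath v p.
Proof.
case: p => [|e p] /=; first by rewrite lpa_vertex_idem.
by move=> [<- _]; rewrite amulA source_arrow.
Qed.

Lemma rpath_target v p : rpath v p ⋅ lv (path_target v p) = rpath v p.
Proof.
elim: p v => [|e p IH] v /=; first by rewrite lpa_vertex_idem.
by rewrite -amulA IH.
Qed.

Lemma gpath_vertex v p : is_path v p -> gpath v p ⋅ lv v = gpath v p.
Proof.
case: p => [|e p] /=; first by rewrite lpa_vertex_idem.
by move=> [<- _]; rewrite -amulA ghost_source.
Qed.

Lemma vertex_rpath0 u v p : is_path v p -> u <> v -> lv u ⋅ rpath v p = 0.
Proof.
by move=> vp uv; rewrite -(vertex_rpath vp) amulA vertex_orth ?amul0l.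
Qed.

Lemma gpath_vertex0 u v p : is_path v p -> v <> u -> gpath v p ⋅ lv u = 0.
Proof.
by move=> vp uv; rewrite -(gpath_vertex vp) -amulA vertex_orth ?amul0r.
Qed.

Lemma rpath_cat v p q : is_path v (p ++ q) ->
  rpath v (p ++ q) = rpath v p ⋅ rpath (path_target v p) q.
Proof.
elim: p v => [|e p IH] v /=; first by move=> /vertex_rpath.
by move=> [_ /IH->]; rewrite amulA.
Qed.

Lemma gpath_cat v p q : is_path v (p ++ q) ->
  gpath v (p ++ q) = gpath (path_target v p) q ⋅ gpath v p.
Proof.
elim: p v => [|e p IH] v /=; first by move=> /gpath_vertex.
by move=> [_ /IH->]; rewrite amulA.
Qed.

(** By (CK1) common first arrows cancel in p^* q, and the product vanishes at the first
    difference. *)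
Lemma gpath_rpath_cases u v p q : is_path u p -> is_path v q ->
  gpath u p ⋅ rpath v q =
    if u != v then 0
    else if prefix p q then rpath (path_target v p) (drop (size p) q)
    else if prefix q p then gpath (path_target v q) (drop (size q) p) else 0.
Proof.
move=> up vq; case: eqVneq => [uv /=|/eqP uv]; last first.
  rewrite -(vertex_rpath vq) amulA gpath_vertex0 ?amul0l //.
subst u; elim: p v q up vq => [|e p IH] v [|f q] //= up vq.
- by rewrite lpa_vertex_idem.
- by case: vq => <- _; rewrite amulA source_arrow.
- by case: up => <- _; rewrite -amulA ghost_source.
case: up vq => [ev ep] [fv fq]; rewrite -amulA (amulA (lg e)).
rewrite [f == e]eq_sym; have [fe|/eqP fe] := eqVneq e f; last first.
  by rewrite ghost_arrow0 // amul0l amul0r.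
by subst f; rewrite ghost_arrow vertex_rpath // IH.
Qed.

Lemma gpath_rpath v p : is_path v p ->
  gpath v p ⋅ rpath v p = lv (path_target v p).
Proof.
move=> vp; rewrite (gpath_rpath_cases vp vp) eqxx prefix_refl.
by rewrite drop_size.
Qed.

(* The monomial p q^* is encoded by the pair of the encodings of p and q.     *)
Definition monomial := ((vertex G * seq (arrow G)) *
                        (vertex G * seq (arrow G)))%type.

Definition mono (m : monomial) : L :=
  rpath m.1.1 m.1.2 ⋅ gpath m.2.1 m.2.2.

Definition is_mono (m : monomial) : Prop :=
  [/\ is_path m.1.1 m.1.2, is_path m.2.1 m.2.2
    & path_target m.1.1 m.1.2 = path_target m.2.1 m.2.2].

(** An arrow on the right cancels a ghost or kills the monomial; if there is no ghost, it lengthens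
    the path. The loss of one ghost drives the induction in [reduce_ghosts]. *)
Lemma mono_arrow_combo m e : is_mono m -> m.2.1 = source e ->
  combo mono (fun m' => is_mono m' /\ size m'.2.2 = (size m.2.2).-1)
    (mono m ⋅ la e).
Proof.
case: m => [[v p] [u q]] [/= vp uq pq] ue; rewrite /mono /= -amulA.
case: q uq pq => [|f q] /= uq pq.
  rewrite ue source_arrow.
  have -> : rpath v p ⋅ la e = mono ((v, rcons p e), (target e, [::])).
    rewrite /mono /= -cats1 rpath_cat; last first.
      by rewrite cats1 is_path_rcons pq ue.
    by rewrite /= -!amulA lpa_vertex_idem arrow_target.
  apply: combo1; split => //; split => //=.
    by rewrite is_path_rcons pq ue.
  by rewrite path_target_rcons.
have [fe|/eqP fe] := eqVneq f e; last first.
  by rewrite -amulA ghost_arrow0 // !amul0r; apply: combo0.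
case: uq => _ fq; rewrite -amulA -fe ghost_arrow gpath_vertex //.
exact: (@combo1 _ _ _ mono _ ((v, p), (target f, q))).
Qed.

Lemma mono_gen_combo m g : is_mono m ->
  combo mono is_mono (mono m ⋅ class_of (@lpa_rel F G) (Gen F g)).
Proof.
case: m => [[v p] [u q]] [/= vp uq pq]; rewrite /mono /=.
case: g => [w|e|e].
- have [<-|/eqP uw] := eqVneq u w.
    rewrite -amulA gpath_vertex //.
    by apply: (@combo1 _ _ _ mono _ ((v, p), (u, q))).
  by rewrite -amulA gpath_vertex0 // amul0r; apply: combo0.
- have [ue|/eqP ue] := eqVneq u (source e); last first.
    rewrite -/(la e) -(source_arrow e) -amulA (amulA (gpath _ _)).
    by rewrite gpath_vertex0 // amul0l amul0r; apply: combo0.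
  have mP : is_mono ((v, p), (u, q)) by [].
  by apply: combo_sub (mono_arrow_combo mP ue) => m [].
rewrite -/(lg e) -amulA.
have [ue|/eqP ue] := eqVneq u (target e); last first.
  by rewrite -(target_ghost e) !amulA -(amulA (rpath _ _)) gpath_vertex0 //
    amul0r amul0l; apply: combo0.
subst u; exact: (@combo1 _ _ _ mono _ ((v, p), (source e, e :: q))).
Qed.

(** Stability of the span under right multiplication by t is carried along because the case of a
    product ab needs it for b, applied to a. *)
Lemma class_combo t : combo mono is_mono (class_of (@lpa_rel F G) t) /\
  forall x, combo mono is_mono x ->
    combo mono is_mono (x ⋅ class_of (@lpa_rel F G) t).
Proof.
elim: t => [g||t [IH1 IH2]|a [Ha Ka] b [Hb Kb]|k a [Ha Ka]|a [Ha Ka] b [Hb Kb]].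
- split; last first.
    by move=> x; apply: combo_map (linear_amulr _) _ _ => m /mono_gen_combo.
  have vertex_combo v : combo mono is_mono (lv v).
    rewrite -(lpa_vertex_idem F v).
    by apply: (@combo1 _ _ _ mono _ ((v, [::]), (v, [::]))).
  have K x : combo mono is_mono x ->
      combo mono is_mono (x ⋅ class_of (@lpa_rel F G) (Gen F g)).
    by apply: combo_map (linear_amulr _) _ _ => m /mono_gen_combo.
  case: g K => [v|e|e] K; first exact: vertex_combo.
    by have := K _ (vertex_combo (source e)); rewrite -/(la e) source_arrow.
  by have := K _ (vertex_combo (target e)); rewrite -/(lg e) target_ghost.
- by split=> [|x cx]; rewrite class_of0E ?amul0r; apply: combo0.
- rewrite class_ofNE; split=> [|x cx].
    by rewrite -scaleN1r; apply: comboZ.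
  by rewrite amulNr -scaleN1r; apply/comboZ/IH2.
- rewrite class_ofDE; split=> [|x cx]; first exact: comboD.
  by rewrite amulDr; apply: comboD; [apply: Ka|apply: Kb].
- rewrite class_ofZE; split=> [|x cx]; first exact: comboZ.
  by rewrite amulZr; apply/comboZ/Ka.
rewrite class_ofME; split=> [|x cx]; first exact: Kb.
by rewrite amulA; apply/Kb/Ka.
Qed.

Lemma lpa_combo (x : L) : combo mono is_mono x.
Proof. by have [t ->] := lpa_class_surj x; have [] := class_combo t. Qed.

Lemma lpa_local_unit (x : L) : exists s : seq (vertex G),
  forall s', uniq s' -> {subset s <= s'} -> x ⋅ (\sum_(v <- s') lv v) = x.
Proof.
apply: (combo_local_unit (h := fun m => m.2.1)) (lpa_combo x) => m v [mp mq _].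
rewrite -amulA; have [->|/eqP mv] := eqVneq v m.2.1; first by rewrite gpath_vertex.
by rewrite gpath_vertex0 ?amul0r //; apply/nesym.
Qed.

Lemma lpa_neq0_vertex (x : L) : x <> 0 -> exists v, x ⋅ lv v <> 0.
Proof.
move=> x0; apply/not_existsP => xv; apply: x0.
have [s /(_ (undup s))] := lpa_local_unit x.
rewrite undup_uniq amul_sumr => <- //; last by move=> v; rewrite mem_undup.
by apply: big1 => v _; apply: contrapT; apply: xv.
Qed.

Lemma lpa_local_units (s : seq L) :
  exists eps : L, forall x, x \in s -> x ⋅ eps = x.
Proof.
have [S SP] : exists S : seq (vertex G), forall S', uniq S' ->
    {subset S <= S'} -> forall x, x \in s -> x ⋅ (\sum_(v <- S') lv v) = x.
  elim: s => [|x s [S SP]]; first by exists [::].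
  have [S1 S1P] := lpa_local_unit x; exists (S1 ++ S) => S' uS' sub y.
  rewrite inE => /orP[/eqP->|ys].
    by apply: S1P => // v vS; apply: sub; rewrite mem_cat vS.
  by apply: SP => // v vS; apply: sub; rewrite mem_cat vS orbT.
exists (\sum_(v <- undup S) lv v); apply: SP; first exact: undup_uniq.
by move=> v; rewrite mem_undup.
Qed.

End Monomials.

(** * The representation on maximal paths *)

Section MaximalPaths.
Variable G : digraph.

(* A maximal path is padded at a sink: there the sink is repeated with no     *)
(* arrow.                                                                     *)
Definition mpath := nat -> vertex G * option (arrow G).

Definition is_mpath (xi : mpath) : Prop := forall n,
  if (xi n).2 is Some e then source e = (xi n).1 /\ target e = (xi n.+1).1
  else sink (xi n).1 /\ (xi n.+1).1 = (xi n).1.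

Definition mtail (xi : mpath) : mpath := fun n => xi n.+1.

Definition mcons (e : arrow G) (xi : mpath) : mpath :=
  fun n => if n is m.+1 then xi m else (source e, Some e).

Definition mcat (p : seq (arrow G)) (xi : mpath) : mpath := foldr mcons xi p.

Lemma mtailK e xi : mtail (mcons e xi) = xi.
Proof. by []. Qed.

Lemma is_mpath_tail xi : is_mpath xi -> is_mpath (mtail xi).
Proof. by move=> xiP n; apply: (xiP n.+1). Qed.

Lemma is_mpath_cons e xi :
  is_mpath xi -> (xi 0%N).1 = target e -> is_mpath (mcons e xi).
Proof. by move=> xiP xe [|n] /=; [|apply: xiP]. Qed.

Lemma mcons_tail xi e :
  is_mpath xi -> (xi 0%N).2 = Some e -> mcons e (mtail xi) = xi.
Proof.
move=> xiP xe; apply/funext => -[|n] //=.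
by have := xiP 0%N; rewrite xe => -[-> _]; case: (xi 0%N) xe => u ? /= ->.
Qed.

Lemma mtail_source xi e :
  is_mpath xi -> (xi 0%N).2 = Some e -> (mtail xi 0%N).1 = target e.
Proof. by move=> xiP xe; have := xiP 0%N; rewrite xe => -[]. Qed.

Lemma source_mpath xi e :
  is_mpath xi -> (xi 0%N).2 = Some e -> source e = (xi 0%N).1.
Proof. by move=> xiP xe; have := xiP 0%N; rewrite xe => -[]. Qed.

Lemma mcatP v p xi : is_path v p -> is_mpath xi ->
    (xi 0%N).1 = path_target v p ->
  is_mpath (mcat p xi) /\ (mcat p xi 0%N).1 = v.
Proof.
elim: p v => [|e p IH] v //= [<- ep] xiP xp; split => //.
by have [? ?] := IH _ ep xiP xp; apply: is_mpath_cons.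
Qed.

Lemma mpath_exists v : exists2 xi, is_mpath xi & (xi 0%N).1 = v.
Proof.
pose out u : option (arrow G) :=
  if pselect (exists e, source e = u) is left h then Some (projT1 (cid h))
  else None.
have outP u : if out u is Some e then source e = u else sink u.
  rewrite /out; case: pselect => [h|h]; first by case: cid.
  by move=> e eu; apply: h; exists e.
pose nxt u := if out u is Some e then target e else u.
exists (fun n => (iter n nxt v, out (iter n nxt v))) => // n /=.
by rewrite /nxt; case: (out _) (outP (iter n nxt v)).
Qed.

End MaximalPaths.

Section Representation.
Variables (F : fieldType) (G : digraph).
Variables (K : fieldType) (iota : {rmorphism F -> K}) (t : K).
Hypothesis t0 : t != 0.
Local Notation X := (mpath G).
Local Notation L := (lpa F G).
Local Notation lv := (@lpa_vertex F G).
Local Notation la := (@lpa_arrow F G).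
Local Notation lg := (@lpa_ghost F G).

(** A vertex restricts f to the maximal paths starting there, e pulls f back along deletion of a
    first arrow e, and e^* along its insertion. The factors t and t^-1 record the degree. Sequences
    that are not maximal paths receive the value 0. *)
Definition gen_act (g : lpa_gen G) (f : X -> K) (xi : X) : K :=
  match g with
  | Vertex v => if `[< is_mpath xi /\ (xi 0%N).1 = v >] then f xi else 0
  | Arrow e =>
      if `[< is_mpath xi /\ (xi 0%N).2 = Some e >] then t * f (mtail xi) else 0
  | Ghost e =>
      if `[< is_mpath xi /\ (xi 0%N).1 = target e >]
      then t^-1 * f (mcons e xi) else 0
  end.

Fixpoint term_act (a : term F (lpa_gen G)) (f : X -> K) (xi : X) : K :=
  match a with
  | Gen g => gen_act g f xi
  | Zero => 0
  | Opp a => - term_act a f xi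
  | Add a b => term_act a f xi + term_act b f xi
  | Scale k a => iota k * term_act a f xi
  | Mul a b => term_act a (term_act b f) xi
  end.

Lemma term_act_linear a (c : K) f g xi :
  term_act a (fun x => c * f x + g x) xi = c * term_act a f xi + term_act a g xi.
Proof.
elim: a f g xi => [[v|e|e]||a IH|a IHa b IHb|k a IH|a IHa b IHb] f g xi /=.
- by case: ifP => // _; rewrite mulr0 addr0.
- by case: ifP => _; rewrite ?mulr0 ?addr0 // mulrDr mulrCA.
- by case: ifP => _; rewrite ?mulr0 ?addr0 // mulrDr mulrCA.
- by rewrite mulr0 addr0.
- by rewrite IH opprD mulrN.
- by rewrite IHa IHb mulrDr addrACA.
- by rewrite IH mulrDr mulrCA.
rewrite -IHa; congr (term_act a _ xi); apply/funext => x; exact: IHb.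
Qed.

Lemma term_act_scale a c f xi :
  term_act a (fun x => c * f x) xi = c * term_act a f xi.
Proof.
have a0 : term_act a (fun=> 0) xi = 0.
  have := term_act_linear a (-1) (fun=> 0) (fun=> 0) xi.
  have -> : (fun _ : X => -1 * 0 + 0 : K) = (fun=> 0).
    by apply/funext => x; rewrite mulr0 addr0.
  by rewrite mulN1r addNr.
rewrite -[RHS]addr0 -a0 -term_act_linear; congr (term_act a _ xi).
by apply/funext => x; rewrite addr0.
Qed.

Lemma term_act_big (s : seq (arrow G)) (T : arrow G -> term F (lpa_gen G)) f xi :
  term_act (\big[@Add F _/Zero]_(e <- s) T e) f xi =
  \sum_(e <- s) term_act (T e) f xi.
Proof. by apply: (big_morph (fun a => term_act a f xi)). Qed.

(** For (CK2): a maximal path from v begins with exactly one of the listed arrows, since a nonempty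
    list means that v is no sink. *)
Lemma term_act_rel a b : lpa_rel a b -> term_act a = term_act b.
Proof.
move=> ab; apply/funext => f; apply/funext => xi.
case: a b / ab => [u|u v uv|e|e|e|e|e|e e' ee'|v s s0 us sP] /=.
- by case: ifP => // ->.
- case: ifP => // /asboolP[_ xu]; case: ifP => // /asboolP[_ xv].
  by case: uv; rewrite -xu.
- case: ifP => [//|/asboolP xN]; case: ifP => // /asboolP[xiP xe].
  by case: xN; rewrite (source_mpath xiP xe).
- case: ifP => // /asboolP[xiP xe]; case: ifP => [//|/asboolP xN]; case: xN.
  by split; [apply: is_mpath_tail|apply: mtail_source].
- by case: ifP => // ->.
- case: ifP => // /asboolP[xiP xe]; case: ifP => [//|/asboolP xN]; case: xN.
  by split; first exact: is_mpath_cons.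
- case: ifP => // /asboolP[xiP xe]; case: ifP => [_|/asboolP xN].
    by rewrite mtailK mulKf.
  by case: xN; split; first exact: is_mpath_cons.
- case: ifP => // /asboolP[xiP xe]; case: ifP => [|_]; last by rewrite mulr0.
  by move=> /asboolP[_ [/ee']].
rewrite term_act_big /=; case: ifP => [/asboolP[xiP xv]|/asboolP xN]; last first.
  rewrite big_seq big1 // => e /sP ev; case: ifP => // /asboolP[xiP xe].
  by case: xN; rewrite -ev (source_mpath xiP xe).
case xe : (xi 0%N).2 => [e|].
  have ev := source_mpath xiP xe; rewrite (bigD1_seq e) //=; last first.
    by apply/sP; rewrite ev.
  rewrite asboolT // asboolT; last first.
    by split; [apply: is_mpath_tail|apply: mtail_source].
  rewrite mcons_tail // mulVKf // big1 ?addr0 // => e' /eqP e'e.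
  by case: ifP => // /asboolP[_ [/esym]].
case: s s0 sP {us} => // e s _ sP.
have := xiP 0%N; rewrite xe => -[xs _]; case: (xs e).
by rewrite xv; apply/sP; rewrite mem_head.
Qed.

Lemma term_act_cong a b : cong (@lpa_rel F G) a b -> term_act a = term_act b.
Proof.
elim=> {a b} [a b /term_act_rel//|//|a b _ -> //|b a c _ -> _ -> //
  |a a' _ E|a a' b b' _ Ea _ Eb|k a a' _ E|a a' b b' _ Ea _ Eb
  |a b c|a b|a|a|k l a|a|k a b|k l a|a b c|a b c|a b c|k a b|k a b];
  apply/funext => f; apply/funext => xi //=.
- by rewrite E.
- by rewrite Ea Eb.
- by rewrite E.
- by rewrite Ea Eb.
- by rewrite addrA.
- by rewrite addrC.
- by rewrite add0r.
- by rewrite addNr.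
- by rewrite rmorphM mulrA.
- by rewrite rmorph1 mul1r.
- by rewrite mulrDr.
- by rewrite rmorphD mulrDl.
- have -> : (fun x => term_act b f x + term_act c f x) =
      (fun x => 1 * term_act b f x + term_act c f x).
    by apply/funext => x; rewrite mul1r.
  by rewrite term_act_linear mul1r.
exact: term_act_scale.
Qed.

Definition lpa_act (x : L) : (X -> K) -> X -> K :=
  term_act (repr (x : {eq_quot (cong_equiv (@lpa_rel F G))})%qT).

Lemma lpa_act_class a : lpa_act (class_of (@lpa_rel F G) a) = term_act a.
Proof.
by apply: term_act_cong; apply/class_ofP; rewrite {1}/class_of reprK.
Qed.

Lemma lpa_actD x y f xi : lpa_act (x + y) f xi = lpa_act x f xi + lpa_act y f xi.
Proof.
have [[a ->] [b ->]] := (lpa_class_surj x, lpa_class_surj y).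
by rewrite -class_ofDE !lpa_act_class.
Qed.

Lemma lpa_actZ k x f xi : lpa_act (k *: x) f xi = iota k * lpa_act x f xi.
Proof. by have [a ->] := lpa_class_surj x; rewrite -class_ofZE !lpa_act_class. Qed.

Lemma lpa_act0 f xi : lpa_act 0 f xi = 0.
Proof. by rewrite -class_of0E lpa_act_class. Qed.

Lemma lpa_actB x y f xi : lpa_act (x - y) f xi = lpa_act x f xi - lpa_act y f xi.
Proof. by rewrite lpa_actD -scaleN1r lpa_actZ rmorphN1 mulN1r. Qed.

Lemma lpa_actM x y f : lpa_act (x ⋅ y) f = lpa_act x (lpa_act y f).
Proof.
have [[a ->] [b ->]] := (lpa_class_surj x, lpa_class_surj y).
by rewrite -class_ofME !lpa_act_class.
Qed.

Lemma lpa_act_scale x (c : K) f xi :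
  lpa_act x (fun y => c * f y) xi = c * lpa_act x f xi.
Proof.
have [a ->] := lpa_class_surj x; rewrite !lpa_act_class.
exact: term_act_scale.
Qed.

Lemma lpa_act_vertex v f xi : is_mpath xi -> (xi 0%N).1 = v ->
  lpa_act (lv v) f xi = f xi.
Proof. by move=> xiP xv; rewrite lpa_act_class /= asboolT. Qed.

Lemma lpa_act_vertex0 v f xi : ~ (is_mpath xi /\ (xi 0%N).1 = v) ->
  lpa_act (lv v) f xi = 0.
Proof. by move=> xv; rewrite lpa_act_class /= asboolF. Qed.

Lemma lpa_act_rpath v p f xi : is_path v p -> is_mpath xi ->
    (xi 0%N).1 = path_target v p ->
  lpa_act (rpath F v p) f (mcat p xi) = t ^+ size p * f xi.
Proof.
move=> vp xiP; elim: p v vp => [|e p IH] v /= vp xp.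
  by rewrite lpa_act_vertex // mul1r.
case: vp => _ ep; have [yP yp] := mcatP ep xiP xp.
rewrite lpa_actM lpa_act_class /= asboolT; last first.
  by split=> //; apply: is_mpath_cons.
by rewrite mtailK IH // mulrA exprS.
Qed.

Lemma vertex_neq0 v : lv v <> 0.
Proof.
move=> v0; have [xi xiP xv] := mpath_exists v.
have := lpa_act_vertex (fun=> 1) xiP xv; rewrite v0 lpa_act0 => /eqP.
by rewrite eq_sym oner_eq0.
Qed.

Section Character.
Variables (v : vertex G) (xi : X).
Hypotheses (xiP : is_mpath xi) (xv : (xi 0%N).1 = v).
Hypothesis xi_uniq : forall xi', is_mpath xi' -> (xi' 0%N).1 = v -> xi' = xi.

(** If xi is the only maximal path from v, the functions supported on xi form a line stable under
    vLv, and this is the scalar by which an element of vLv acts on it. *)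
Definition corner_char (x : L) : K := lpa_act x (fun=> 1) xi.

Lemma corner_charM x y : x = x ⋅ lv v -> y = lv v ⋅ y ->
  corner_char (x ⋅ y) = corner_char x * corner_char y.
Proof.
move=> xE yE; rewrite /corner_char lpa_actM xE.
rewrite [lpa_act (x ⋅ lv v) (fun=> 1)]lpa_actM lpa_actM [RHS]mulrC.
rewrite -lpa_act_scale; congr (lpa_act x _ xi); apply/funext => z.
have [[zP zv]|zN] := pselect (is_mpath z /\ (z 0%N).1 = v); last first.
  by rewrite !lpa_act_vertex0 // mulr0.
by rewrite !lpa_act_vertex // mulr1 (xi_uniq zP zv).
Qed.

Lemma corner_char_vertex : corner_char (lv v) = 1.
Proof. exact: lpa_act_vertex. Qed.

Lemma corner_char_rpath p : is_path v p -> path_target v p = v ->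
  corner_char (rpath F v p) = t ^+ size p.
Proof.
move=> vp pv; have xp : (xi 0%N).1 = path_target v p by rewrite pv.
rewrite /corner_char -{1}(xi_uniq (mcatP vp xiP xp).1 (mcatP vp xiP xp).2).
by rewrite lpa_act_rpath // mulr1.
Qed.

End Character.

(** To be applied with S the set of Laurent polynomials in t: the action only adds and multiplies by
    scalars, t and t^-1. *)
Lemma lpa_act_closed (S : K -> Prop) : S 0 ->
    (forall x y, S x -> S y -> S (x + y)) -> (forall k x, S x -> S (iota k * x)) ->
    (forall x, S x -> S (t * x)) -> (forall x, S x -> S (t^-1 * x)) ->
  forall x f xi, (forall y, S (f y)) -> S (lpa_act x f xi).
Proof.
move=> S0 SD SZ St SV x f xi Sf; have [a ->] := lpa_class_surj x.
rewrite lpa_act_class.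
elim: a f xi Sf => [[v|e|e]||a IH|a IHa b IHb|k a IH|a IHa b IHb] f xi Sf /=.
- by case: ifP.
- by case: ifP => // _; apply: St.
- by case: ifP => // _; apply: SV.
- by [].
- by rewrite -mulN1r -(rmorphN1 iota); apply/SZ/IH.
- by apply: SD; [apply: IHa|apply: IHb].
- exact/SZ/IH.
by apply: IHa => y; apply: IHb.
Qed.

End Representation.

(** * The reduction theorem *)

Lemma lpa_vertex_neq0 (F : fieldType) (G : digraph) (v : vertex G) :
  lpa_vertex F v <> 0.
Proof. exact: (@vertex_neq0 F G F idfun 1 (oner_neq0 _)). Qed.

Lemma seq_min_exists (T : eqType) (h : T -> nat) (s : seq T) : s <> [::] ->
  exists2 m, m \in s & forall m', m' \in s -> (h m <= h m')%N.
Proof.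
elim: s => // a s IH _; have [->|/eqP s0] := eqVneq s [::].
  by exists a => [|m']; rewrite ?mem_head // inE => /eqP->.
have [m ms mP] := IH s0; have [am|ma] := leqP (h a) (h m).
  exists a; first exact: mem_head.
  by move=> m'; rewrite inE => /orP[/eqP->//|/mP]; apply: leq_trans.
exists m; first by rewrite inE ms orbT.
by move=> m'; rewrite inE => /orP[/eqP->|/mP//]; apply: ltnW.
Qed.

(** This separates the vertices emitting finitely many arrows, where (CK2) is at hand unless they
    are sinks, from those that emit an arrow outside any given finite list. *)
Lemma seq_finite_or_fresh (T : eqType) (P : T -> Prop) :
  (exists s : seq T, forall x, P x -> x \in s) \/
  (forall s : seq T, exists2 x, P x & x \notin s).
Proof.
have [h|h] := pselect (exists s : seq T, forall x, P x -> x \in s).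
  by left.
right=> s; apply: contrapT => sP; apply: h; exists s => x Px.
by apply: contrapT => /negP xs; apply: sP; exists x.
Qed.

(* If z were a prefix of r z then z would be |r|-periodic; but the last       *)
(* letter of z = c^n a f and the one |c||r| places before it are f and e.     *)
Lemma not_prefix_exit (T : eqType) (c a b r : seq T) (e f : T) (n : nat) :
    c = a ++ e :: b -> f != e -> r <> [::] -> (size r <= n)%N ->
  forall z, z = flatten (nseq n c) ++ a ++ [:: f] -> ~~ prefix z (r ++ z).
Proof.
move=> cE fe r0 rn z zE; apply/negP => /prefixP[s rzE]; case/eqP: fe.
set d := size r in rn; have d0 : (0 < d)%N by rewrite lt0n size_eq0; apply/eqP.
pose j := (n * size c + size a)%N.
have sfl m : size (flatten (nseq m c)) = (m * size c)%N.
  by elim: m => //= m IH; rewrite size_cat IH mulSn.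
have sz : size z = j.+1 by rewrite zE !size_cat sfl addnA addn1.
have zj : nth f z j = f.
  rewrite zE nth_cat sfl ltnNge leq_addr addKn /=.
  by rewrite nth_cat ltnn subnn.
have step i : (d <= i < j.+1)%N -> nth f z i = nth f z (i - d).
  move=> /andP[di ij]; have : nth f (r ++ z) i = nth f (z ++ s) i by rewrite rzE.
  by rewrite nth_cat [in RHS]nth_cat sz ij ltnNge di.
have steps k : (k * d <= j)%N -> nth f z j = nth f z (j - k * d).
  elim: k => [|k IH] kj; first by rewrite mul0n subn0.
  have dj : (d + k * d <= j)%N by rewrite -mulSn.
  rewrite IH; last by apply: leq_trans kj; rewrite leq_mul2r leqnSn orbT.
  rewrite step; first by rewrite -subnDA addnC -mulSn.
  rewrite ltnS leq_subr leq_subRL ?[(k * d + d)%N]addnC ?dj //.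
  by rewrite (leq_trans _ dj) ?leq_addl.
have cdj : (size c * d <= j)%N.
  by rewrite mulnC (leq_trans _ (leq_addr _ _)) // leq_mul2r rn orbT.
rewrite -zj (steps _ cdj).
have -> : (j - size c * d = (n - d) * size c + size a)%N.
  by rewrite /j mulnBl [(size c * d)%N]mulnC addnBAC // leq_mul2r rn orbT.
rewrite zE -(subnK rn) nseqD flatten_cat -catA nth_cat sfl.
rewrite addnK ltnNge leq_addr addKn /=; case: d d0 {step steps cdj rn} => // d _.
by rewrite /= cE -!catA nth_cat ltnn subnn.
Qed.

Section Reduction.
Variables (F : fieldType) (G : digraph).
Local Notation L := (lpa F G).
Local Notation lv := (@lpa_vertex F G).
Local Notation la := (@lpa_arrow F G).
Local Notation lg := (@lpa_ghost F G).
Local Notation rpath := (@rpath F G).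
Local Notation gpath := (@gpath F G).
Implicit Types (u v w : vertex G) (p q c : seq (arrow G)) (x y : L).

Definition reaches x y := exists a b, y = a ⋅ x ⋅ b.

Lemma reaches_trans x y z : reaches x y -> reaches y z -> reaches x z.
Proof.
by move=> [a [b ->]] [c [d ->]]; exists (c ⋅ a), (b ⋅ d); rewrite !amulA.
Qed.

(** As L may have no unit, the left factor is a finite sum of vertices that fixes x. *)
Lemma reaches_mulr x b : reaches x (x ⋅ b).
Proof.
have [eps epsP] : exists eps, eps ⋅ x = x.
  suff [s sP] : exists s : seq (vertex G),
      forall s', uniq s' -> {subset s <= s'} -> (\sum_(v <- s') lv v) ⋅ x = x.
    exists (\sum_(v <- undup s) lv v); apply: sP; first exact: undup_uniq.
    by move=> v; rewrite mem_undup.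
  elim/combo_ind: x / (lpa_combo x) => [|k m x [mp _ _] [s sP]].
    by exists [::] => s' _ _; rewrite amul0r.
  exists (m.1.1 :: s) => s' us' ss'; rewrite amulDr amulZr sP //; last first.
    by move=> i si; apply: ss'; rewrite inE si orbT.
  congr (_ *: _ + _); rewrite amul_suml (bigD1_seq m.1.1) //=; last first.
    by apply: ss'; rewrite mem_head.
  rewrite amulA vertex_rpath // big1 ?addr0 // => v /eqP vm.
  by rewrite amulA vertex_rpath0 ?amul0l.
by exists eps, b; rewrite epsP.
Qed.

Definition is_path_to v (m : vertex G * seq (arrow G)) : Prop :=
  is_path m.1 m.2 /\ path_target m.1 m.2 = v.

Definition closed_path v p : Prop :=
  [/\ is_path v p, p <> [::] & path_target v p = v].

Definition rmono (m : vertex G * seq (arrow G)) : L := rpath m.1 m.2.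

(** Take p to be a shortest path occurring in y. For another term q, the product p^* q is 0 or the
    rest of q after p, which is a nonempty closed path at v; by minimality q is not a proper prefix
    of p. *)
Lemma extract_min v y : y <> 0 -> combo rmono (is_path_to v) y ->
  exists u p (k : F) y', [/\ is_path u p /\ path_target u p = v, k != 0,
    gpath u p ⋅ y = k *: lv v + y' & combo (rpath v) (closed_path v) y'].
Proof.
move=> y0 /combo_uniq[s [c [us sP yE]]].
have s0 : s <> [::] by move=> s0; apply: y0; rewrite yE s0 big_nil.
have [[u p] ms mP] := seq_min_exists (fun m => size m.2) s0.
have [[/= up pv] k0] := sP _ ms.
exists u, p, (c (u, p)).
exists (\sum_(m <- s | m != (u, p)) c m *: (gpath u p ⋅ rmono m)); split => //.
  rewrite yE amul_sumr (bigD1_seq (u, p)) //= amulZr gpath_rpath // pv.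
  by congr (_ + _); apply: eq_bigr => m _; rewrite amulZr.
rewrite big_seq_cond; apply: big_ind => [|x1 x2|[u' q] /andP[qs qp]].
- exact: combo0.
- exact: comboD.
apply: comboZ; have [[/= uq qv] _] := sP _ qs; rewrite /rmono /=.
rewrite gpath_rpath_cases //; case: eqVneq => [uu' /=|_]; last exact: combo0.
subst u'; case: ifP => [/prefixP[r qE]|_].
  subst q; rewrite drop_size_cat // pv; apply: combo1; split.
  - by move: uq; rewrite is_path_cat pv => -[].
  - by move=> r0; move: qp; rewrite r0 cats0 eqxx.
  - by rewrite -[in RHS]qv path_target_cat pv.
case: ifP => [/prefixP[r pE]|_]; last exact: combo0.
have := mP _ qs; rewrite /= pE size_cat -{2}[size q]addn0 leq_add2l leqn0.
rewrite size_eq0 => /eqP r0; move: qp; rewrite pE r0 cats0 eqxx //.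
Qed.

Lemma closed_first_arrows v y : combo (rpath v) (closed_path v) y ->
  exists s : seq (arrow G), forall f, f \notin s -> lg f ⋅ y = 0.
Proof.
elim/combo_ind => [|k [|e p] x [//= _ _ _] [s sP]].
  by exists [::] => f _; rewrite amul0r.
exists (e :: s) => f; rewrite inE negb_or => /andP[/eqP fe /sP fx].
by rewrite amulDr amulZr fx amulA ghost_arrow0 // amul0l scaler0 addr0.
Qed.

Lemma closed_size_bound v y : combo (rpath v) (closed_path v) y ->
  exists n, combo (rpath v) (fun p => closed_path v p /\ (size p <= n)%N) y.
Proof.
elim/combo_ind => [|k p x cp [n cx]]; first by exists 0%N; apply: combo0.
exists (maxn (size p) n); apply: comboD.
  by apply/comboZ/combo1; rewrite leq_maxl.
by apply: combo_sub cx => q [? /leq_trans->]; rewrite ?leq_maxr.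
Qed.

(** A monomial p q^* whose q begins with e ends in the factor e^*, so e e^* fixes it and f f^* kills
    it for f <> e. *)
Lemma ghost_local_unit z :
    combo (@mono F G) (fun m => is_mono m /\ ~~ (m.2.2 == [::])) z ->
  exists s : seq (arrow G), forall s', uniq s' -> {subset s <= s'} ->
    z ⋅ (\sum_(e <- s') la e ⋅ lg e) = z.
Proof.
move=> /(combo_local_unit (h := fun m => ohead m.2.2)
  (eps := fun o => if o is Some e then la e ⋅ lg e else 0)).
case=> [m o [[_ mq _] m0]|s sP].
  case: m mq m0 => [[u p] [v [//|e q]]] /= [_ eq] _; rewrite /mono /=.
  case: o => [f|]; last by rewrite amul0r.
  have [[->]|fe] := eqVneq (Some f) (Some e).
    rewrite -!amulA (amulA (lg e)) ghost_arrow target_ghost //.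
  rewrite -!amulA (amulA (lg e)) ghost_arrow0 ?amul0l ?amul0r // => ef.
  by case/eqP: fe; rewrite ef.
exists (pmap id s) => s' us' ss'.
(* The dummy index [None], which arises from the type of [ohead], has weight 0 and can be added
   freely. *)
have := sP (None :: map Some s').
rewrite big_cons add0r big_map; apply.
  have someI : injective (@Some (arrow G)) by move=> ? ? [].
  by rewrite /= map_inj_uniq // us' andbT; apply/negP => /mapP[].
move=> [e|] es; rewrite inE //= mem_map; last by move=> ? ? [].
by apply: ss'; rewrite mem_pmap map_id.
Qed.

Lemma mono_nil v x :
    combo (@mono F G) (fun m => [/\ is_mono m, m.2.1 = v & m.2.2 = [::]]) x ->
  combo rmono (is_path_to v) x.
Proof.
move=> cx; have idL : linear (fun x : L => x) by [].
apply: (combo_map idL _ cx) => -[[u p] [w q]] [[/= up _ pq] wv q0].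
rewrite /= in pq wv q0; subst w q.
rewrite /mono /= -[v]pq rpath_target.
by apply: (@combo1 _ _ _ rmono _ (u, p)); split.
Qed.

(** Induction on the bound n for the number of ghosts. Replace x by some xv <> 0. If xe <> 0 for
    some arrow e, then xe has fewer ghosts. Otherwise write x = y + z with y free of ghosts and all
    monomials of z ending in a ghost: as x kills all arrows, y times a large enough sum of e e^*
    equals -z. Both for finitely and for infinitely many arrows leaving v this contradicts z <> 0,
    so x = y. *)
Lemma reduce_ghosts n x : x <> 0 ->
    combo (@mono F G) (fun m => is_mono m /\ (size m.2.2 <= n)%N) x ->
  exists v y, [/\ y <> 0, reaches x y & combo rmono (is_path_to v) y].
Proof.
elim: n x => [|n IH] x x0 cx.
  have [v xv0] := lpa_neq0_vertex x0; exists v, (x ⋅ lv v); split=> //.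
    exact: reaches_mulr.
  apply: mono_nil; apply: combo_map (linear_amulr _) _ _ cx.
  move=> [[u p] [w [|e q]]] [mP //= _]; have [_ /= wq _] := mP.
  rewrite /mono /= -amulA; have [<-|/eqP wv] := eqVneq w v.
    rewrite lpa_vertex_idem.
    exact: (@combo1 _ _ _ (@mono F G) _ ((u, p), (w, [::]))).
  by rewrite vertex_orth // amul0r; apply: combo0.
have [v xv0] := lpa_neq0_vertex x0.
have xR := reaches_mulr x (lv v).
set x1 := x ⋅ lv v in xv0 xR.
have {}cx : combo (@mono F G)
    (fun m => [/\ is_mono m, (size m.2.2 <= n.+1)%N & m.2.1 = v]) x1.
  apply: combo_map (linear_amulr _) _ _ cx.
  move=> [[u p] [w q]] [mP /= sq]; have [_ /= wq _] := mP.
  rewrite /mono /= -amulA; have [<-|/eqP wv] := eqVneq w v.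
    rewrite gpath_vertex //.
    exact: (@combo1 _ _ _ (@mono F G) _ ((u, p), (w, q))).
  by rewrite gpath_vertex0 // amul0r; apply: combo0.
have x1v : x1 ⋅ lv v = x1 by rewrite /x1 -amulA lpa_vertex_idem.
have [[e ev xe0]|xN] := pselect (exists2 e, source e = v & x1 ⋅ la e <> 0).
  have /(IH _ xe0)[v' [y [y0 yR cy]]] : combo (@mono F G)
      (fun m => is_mono m /\ (size m.2.2 <= n)%N) (x1 ⋅ la e).
    apply: combo_map (linear_amulr _) _ _ cx => m [mP mn mv].
    have mve : m.2.1 = source e by rewrite mv.
    apply: combo_sub (mono_arrow_combo F mP mve) => m' [? ->]; split => //.
    by case: (size _) mn.
  exists v', y; split => //; apply: reaches_trans yR.
  exact: reaches_trans xR (reaches_mulr _ _).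
have {}xN e : x1 ⋅ la e = 0.
  have [ev|/eqP ev] := eqVneq (source e) v.
    by apply: contrapT => xe; apply: xN; exists e.
  by rewrite -x1v -(source_arrow F e) -amulA (amulA (lv v)) vertex_orth ?amul0l
    ?amul0r //; apply/nesym.
have [y [z [xE cy cz]]] := combo_split (fun m => m.2.2 == [::]) cx.
have {}cy : combo rmono (is_path_to v) y.
  by apply: mono_nil; apply: combo_sub cy => m [[? _ ?] /eqP].
have yv : y ⋅ lv v = y.
  elim/combo_ind: y / cy {xE} => [|k m y [_ mv] yv]; first by rewrite amul0l.
  by rewrite amulDl amulZl yv /rmono -[in lv v]mv rpath_target.
have [s sP] : exists s : seq (arrow G), forall s', uniq s' ->
    {subset s <= s'} -> z ⋅ (\sum_(e <- s') la e ⋅ lg e) = z.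
  by apply: ghost_local_unit; apply: combo_sub cz => m [[]].
have [z0|z0] := pselect (z = 0).
  by exists v, x1; split => //; rewrite xE z0 addr0.
have yz s' : uniq s' -> {subset s <= s'} ->
    y ⋅ (\sum_(e <- s') la e ⋅ lg e) = - z.
  move=> us' ss'; apply/eqP; rewrite -addr_eq0 -[X in _ + X](sP s') //.
  rewrite -amulDl -xE amul_sumr big1 // => e _.
  by rewrite amulA xN amul0l.
have [[l lP]|fresh] := seq_finite_or_fresh (fun e : arrow G => source e = v).
  (* All arrows from v lie in S, so by (CK2) those of S with source v have sum of e e^* equal to v;
     thus y = -z and x1 = 0. *)
  case: xv0; pose S := undup (s ++ l).
  have yE : y ⋅ (\sum_(e <- S) la e ⋅ lg e) = - z.
    by apply: yz; rewrite ?undup_uniq // => e es; rewrite mem_undup mem_cat es.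
  pose T := [seq e <- S | source e == v].
  have yT : y ⋅ (\sum_(e <- T) la e ⋅ lg e) = - z.
    rewrite -yE big_filter [in RHS](bigID (fun e => source e == v)) /= amulDr.
    rewrite [X in _ = _ + X]amul_sumr [X in _ = _ + X]big1 ?addr0 // => e /eqP ev.
    by rewrite -yv -(source_arrow F e) -amulA !(amulA (lv v)) vertex_orth
      ?amul0l ?amul0r //; apply/nesym.
  have T0 : T <> [::].
    by move=> T0; case: z0; apply/oppr_inj; rewrite -yT T0 big_nil amul0r oppr0.
  rewrite xE -[X in X + _]yv (@vertex_CK2 F G v T) ?yT ?addNr //.
    by rewrite filter_uniq ?undup_uniq.
  move=> e; rewrite mem_filter mem_undup mem_cat; split=> [/andP[/eqP]//|ev].
  by rewrite ev eqxx lP ?orbT.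
have y0 : y <> 0.
  move=> y0; case: z0; have := yz (undup s) (undup_uniq s).
  rewrite y0 amul0l => /(_ _)/esym/eqP; rewrite oppr_eq0 => H; apply/eqP/H.
  by move=> e; rewrite mem_undup.
have [u [p [k [y' [[up pv] k0 yE cy']]]]] := extract_min y0 cy.
have [s2 s2P] := closed_first_arrows cy'.
(* Outside s, f is killed by z, whence yf = 0; outside s2, f^* kills y', so f^* p^* y f = k t(f),
   which is not 0. *)
have [f fv] := fresh (s ++ s2); rewrite mem_cat negb_or => /andP[fs fs2].
have zf : z ⋅ la f = 0.
  rewrite -(sP (undup s)) ?undup_uniq //; last by move=> e; rewrite mem_undup.
  rewrite -amulA amul_suml [X in _ ⋅ X]big_seq big1 ?amul0r // => e.
  rewrite mem_undup => es; rewrite -amulA ghost_arrow0 ?amul0r // => ef.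
  by rewrite -ef es in fs.
have yf : y ⋅ la f = 0 by rewrite -(xN f) xE amulDl zf addr0.
have : lg f ⋅ (gpath u p ⋅ y ⋅ la f) = 0 by rewrite -amulA yf !amul0r.
rewrite yE amulA amulDr (s2P f) // addr0 amulZr -fv ghost_source amulZl.
rewrite ghost_arrow => /eqP; rewrite scaler_eq0 (negPf k0) /=.
by move=> /eqP/lpa_vertex_neq0.
Qed.

Lemma reduce_to_paths x : x <> 0 ->
  exists v y, [/\ y <> 0, reaches x y & combo rmono (is_path_to v) y].
Proof.
move=> x0; have [n cx] : exists n,
    combo (@mono F G) (fun m => is_mono m /\ (size m.2.2 <= n)%N) x.
  elim/combo_ind: x / (lpa_combo x) {x0} => [|k m x mP [n cx]].
    by exists 0%N; apply: combo0.
  exists (maxn (size m.2.2) n); apply: comboD.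
    by apply/comboZ/combo1; rewrite leq_maxl.
  by apply: combo_sub cx => q [? /leq_trans->]; rewrite ?leq_maxr.
exact: reduce_ghosts cx.
Qed.

End Reduction.

(** * Cycles without exit *)

Section RigidCycles.
Variable G : digraph.
Implicit Types (u v w : vertex G) (c : seq (arrow G)).

(** A cycle without exit, possibly traversed several times. *)
Definition rigid_cycle v c : Prop :=
  closed_path v c /\ forall e f, e \in c -> source f = source e -> f = e.

Lemma closed_path_next v c e : closed_path v c -> e \in c ->
  exists2 f, f \in c & source f = target e.
Proof.
move=> [vc c0 cv] /splitPr ec; case: ec vc cv {c0} => a [|f b].
  move=> vc; rewrite path_target_cat /path_target /= => ev.
  case: a vc => [|g a] /= [gv _]; first by exists e; rewrite ?mem_head // gv -ev.
  by exists g; rewrite ?mem_head // gv -ev.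
move=> /is_path_cat[_ /= [_ [fe _]]] _; exists f => //.
by rewrite mem_cat !inE eqxx !orbT.
Qed.

(** There is never a choice: every vertex met lies on c and emits exactly one arrow. *)
Lemma rigid_cycle_mpath v c xi xi' : rigid_cycle v c ->
    is_mpath xi -> (xi 0%N).1 = v -> is_mpath xi' -> (xi' 0%N).1 = v ->
  xi' = xi.
Proof.
move=> [cP rP] xiP xv xiP' xv'.
have next (z : mpath G) n e : is_mpath z -> e \in c -> (z n).1 = source e ->
    z n = (source e, Some e) /\ (z n.+1).1 = target e.
  move=> zP ec zn; have := zP n; case: (z n) zn => u [f|] /= ->.
    by move=> [/(rP _ _ ec)-> <-].
  by move=> [/(_ e)].
suff H n : exists e, [/\ e \in c, (xi n).1 = source e & (xi' n).1 = source e].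
  apply/funext => n; have [e [ec xe xe']] := H n.
  by rewrite (next xi n e xiP ec xe).1 (next xi' n e xiP' ec xe').1.
elim: n => [|n [e [ec xe xe']]]; last first.
  have [f fc fe] := closed_path_next cP ec.
  exists f; split; rewrite // fe.
    exact: (next xi n e xiP ec xe).2.
  exact: (next xi' n e xiP' ec xe').2.
case: cP {rP next} => vc c0 _; case: c vc c0 => // e c [ev _] _.
by exists e; rewrite mem_head ev xv xv'.
Qed.

End RigidCycles.

(** * The Laurent polynomial of an element at a cycle without exit *)

Section LaurentCharacter.
Variables (F : fieldType) (G : digraph).
Local Notation L := (lpa F G).
Local Notation lv := (@lpa_vertex F G).
Local Notation K := {fraction {poly F}}.

Definition laurent_cst : {rmorphism F -> K} := @tofrac {poly F} \o @polyC F.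
Definition laurent_var : K := tofrac 'X.

Lemma laurent_var_neq0 : laurent_var != 0.
Proof. by rewrite tofrac_eq0 polyX_eq0. Qed.

Definition laurent_char (xi : mpath G) : L -> K :=
  corner_char laurent_cst laurent_var xi.

(** The values are Laurent polynomials; this is expressed by clearing the denominator, a power of
    the indeterminate. *)
Lemma laurent_charP xi x :
  exists (P : {poly F}) n, laurent_char xi x * laurent_var ^+ n = tofrac P.
Proof.
apply: (lpa_act_closed laurent_var_neq0
  (S := fun k : K => exists (P : {poly F}) n, k * laurent_var ^+ n = tofrac P)).
- by exists 0, 0%N; rewrite mul0r tofrac0.
- move=> k l [P [m kP]] [Q [n lQ]].
  exists (P * 'X^n + Q * 'X^m), (m + n)%N.
  rewrite mulrDl tofracD !tofracM -kP -lQ !tofracXn -/laurent_var.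
  by rewrite exprD mulrA [in X in _ + X](mulrC (_ ^+ m)) !mulrA.
- move=> k l [P [n lP]]; exists (k%:P * P), n.
  by rewrite -mulrA lP tofracM.
- move=> l [P [n lP]]; exists ('X * P), n.
  by rewrite -mulrA lP tofracM.
- move=> l [P [n lP]]; exists P, n.+1.
  by rewrite exprS mulrCA !mulrA mulfV ?laurent_var_neq0 // mul1r.
by move=> y; exists 1, 0%N; rewrite mulr1 tofrac1.
Qed.

(* Evaluate at 1, where 1 - X^n vanishes but no power of X does.              *)
Lemma one_sub_not_inv xi x n : (1 - laurent_var ^+ n) * laurent_char xi x <> 1.
Proof.
have [P [m PE]] := laurent_charP xi x => E.
have : (1 - 'X^n) * P = 'X^m.
  apply/eqP; rewrite -tofrac_eq tofracM tofracB tofrac1 !tofracXn -PE mulrA.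
  by rewrite -/laurent_var E mul1r.
move/(congr1 (horner^~ 1)); rewrite !hornerE !expr1n subrr mul0r => /eqP.
by rewrite eq_sym oner_eq0.
Qed.

Lemma one_sub_neq0 n : (0 < n)%N -> 1 - laurent_var ^+ n != 0.
Proof.
move=> n0; rewrite -tofrac1 -tofracXn -tofracB tofrac_eq0 subr_eq0.
apply/eqP => /(congr1 (coefp 0)); rewrite /= coef1 coefXn /= ltn_eqF //.
by move/eqP; rewrite oner_eq0.
Qed.

Section AtRigidCycle.
Variables (v : vertex G) (c : seq (arrow G)) (xi : mpath G).
Hypotheses (cP : rigid_cycle v c) (xiP : is_mpath xi) (xv : (xi 0%N).1 = v).

Let xi_uniq xi' : is_mpath xi' -> (xi' 0%N).1 = v -> xi' = xi.
Proof. exact: rigid_cycle_mpath cP xiP xv. Qed.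

Lemma laurent_charM x y : x = x ⋅ lv v -> y = lv v ⋅ y ->
  laurent_char xi (x ⋅ y) = laurent_char xi x * laurent_char xi y.
Proof. exact: (corner_charM _ laurent_var_neq0 xi_uniq). Qed.

Lemma laurent_char_vertex : laurent_char xi (lv v) = 1.
Proof. exact: (corner_char_vertex _ laurent_var_neq0 xiP xv). Qed.

Lemma laurent_char_rpath p : is_path v p -> path_target v p = v ->
  laurent_char xi (rpath F v p) = laurent_var ^+ size p.
Proof. exact: (corner_char_rpath _ laurent_var_neq0 xiP xv xi_uniq). Qed.

Lemma laurent_char_closed y : combo (@rpath F G v) (closed_path v) y ->
  exists P, laurent_char xi y = tofrac ('X * P).
Proof.
elim/combo_ind => [|k p x [vp p0 pv] [P xE]].
  exists 0; rewrite mulr0 tofrac0.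
  by rewrite /laurent_char /corner_char lpa_act0 //; apply: laurent_var_neq0.
rewrite /laurent_char /corner_char lpa_actD ?laurent_var_neq0 //.
rewrite lpa_actZ ?laurent_var_neq0 // -!/(corner_char _ _ _ _).
rewrite -!/(laurent_char xi _) xE laurent_char_rpath //.
case: p p0 {vp pv} => // e p _; exists (k%:P * 'X^(size p) + P).
by rewrite /laurent_var -tofracXn -tofracM -tofracD mulrDr /= exprS mulrCA.
Qed.

(** Nonempty closed paths contribute only positive powers of the indeterminate, so the constant
    coefficient is k. *)
Lemma laurent_char_neq0 k y : k != 0 -> combo (@rpath F G v) (closed_path v) y ->
  laurent_char xi (k *: lv v + y) != 0.
Proof.
move=> k0 /laurent_char_closed[P yE].
rewrite /laurent_char /corner_char lpa_actD ?laurent_var_neq0 //.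
rewrite lpa_actZ ?laurent_var_neq0 // -!/(corner_char _ _ _ _).
rewrite -!/(laurent_char xi _) yE laurent_char_vertex // mulr1.
rewrite -tofracD tofrac_eq0; apply: contraNneq k0.
by move/(congr1 (coefp 0)); rewrite /= coefD coefC coefXM addr0 coef0 => /eqP.
Qed.

End AtRigidCycle.

Lemma reaches_mull x (a : L) : reaches x (a ⋅ x).
Proof.
have [eps epsP] := lpa_local_units [:: x]; exists a, eps.
by rewrite -amulA epsP ?mem_head.
Qed.

(** Let z run n times round c and then leave by the exit f. For a term r of y, z^* r z could be
    nonzero only if one of z and rz were a prefix of the other; [not_prefix_exit] excludes one case
    and the lengths exclude the other. *)
Lemma exit_kill v c e f n y : closed_path v c -> e \in c -> source f = source e ->
    f <> e ->
    combo (@rpath F G v) (fun p => closed_path v p /\ (size p <= n)%N) y ->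
  exists z, is_path v z /\ gpath F v z ⋅ y ⋅ rpath F v z = 0.
Proof.
move=> [vc _ cv] ec fe /eqP fNe cy.
have [a [b cE]] : exists a b, c = a ++ e :: b.
  by case/splitPr: ec => a b; exists a, b.
exists (flatten (nseq n c) ++ a ++ [:: f]); set z := _ ++ _.
have vz : is_path v z.
  have cn m : is_path v (flatten (nseq m c)) /\
      path_target v (flatten (nseq m c)) = v.
    elim: m => //= m [IH1 IH2].
    by rewrite path_target_cat cv IH2; split=> //; apply/is_path_cat; rewrite cv.
  apply/is_path_cat; rewrite (cn n).2; split; first exact: (cn n).1.
  move: vc; rewrite cE => /is_path_cat[va /= [ea _]].
  by apply/is_path_cat; rewrite /= fe.
split=> //; elim/combo_ind: y / cy => [|k r y [[vr r0 rv] rn] IH].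
  by rewrite amul0r amul0l.
rewrite amulDr amulDl IH addr0 amulZr amulZl -amulA.
have vrz : is_path v (r ++ z) by apply/is_path_cat; rewrite rv.
have -> : rpath F v r ⋅ rpath F v z = rpath F v (r ++ z).
  by rewrite (rpath_cat F vrz) rv.
rewrite gpath_rpath_cases // eqxx /= (negPf (not_prefix_exit cE fNe r0 rn _)) //.
case: ifP => [/prefixP[r' zE]|_]; last by rewrite scaler0.
case: r0; apply/nilP; rewrite /nilp; have := congr1 size zE.
rewrite !size_cat addnAC -[LHS]add0n => /eqP.
by rewrite eqn_add2r eq_sym addn_eq0 => /andP[].
Qed.

(** By [extract_min], x reaches k v + y' with y' a combination of closed paths at v. If some closed
    path at v has an exit, [exit_kill] removes y' and leaves a multiple of a vertex. If there is no
    closed path at v, then y' = 0. Otherwise v lies on a cycle without exit, and the Laurent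
    polynomial of k v + y' has constant coefficient k. *)
Lemma reduction (x : L) : x <> 0 ->
  (exists w, reaches x (lv w)) \/
  (exists v c y, [/\ rigid_cycle v c, reaches x y, y = lv v ⋅ y, y = y ⋅ lv v
     & forall xi, is_mpath xi -> (xi 0%N).1 = v -> laurent_char xi y != 0]).
Proof.
move=> /reduce_to_paths[v [y1 [y10 xy1 cy1]]].
have [u [p [k [y' [[up pv] k0 yE cy']]]]] := extract_min y10 cy1.
have xy : reaches x (k *: lv v + y').
  by apply: reaches_trans xy1 _; rewrite -yE; apply: reaches_mull.
have scale_reach w : reaches x (k *: lv w) -> reaches x (lv w).
  move=> [a [b ab]]; exists (k^-1 *: a), b.
  by rewrite !amulZl -ab scalerA mulVf // scale1r.
have [[c [e [f [cP ec fe fNe]]]]|noexit] := pselect (exists c e f,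
    [/\ closed_path v c, e \in c, source f = source e & f <> e]).
  left; have [n cy] := closed_size_bound cy'.
  have [z [vz zy]] := exit_kill cP ec fe fNe cy; exists (path_target v z).
  apply/scale_reach/(reaches_trans xy); exists (gpath F v z), (rpath F v z).
  rewrite amulDr amulDl zy addr0 amulZr amulZl gpath_vertex //.
  by rewrite gpath_rpath.
have [[c cP]|noc] := pselect (exists c, closed_path v c); last first.
  left; exists v; apply: scale_reach; suff y'0 : y' = 0 by rewrite y'0 addr0 in xy.
  by elim/combo_ind: y' / cy' {yE xy} => // ? q ? cq; case: noc; exists q.
right; exists v, c, (k *: lv v + y').
have cr : rigid_cycle v c.
  split=> // e f ec fe; apply: contrapT => fNe; apply: noexit.
  by exists c, e, f.
split => //.
- rewrite amulDr amulZr lpa_vertex_idem; congr (_ + _).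
  elim/combo_ind: y' / cy' {yE xy} => [|l q y [vq _ _] IH]; first by rewrite amul0r.
  by rewrite amulDr amulZr vertex_rpath -?IH.
- rewrite amulDl amulZl lpa_vertex_idem; congr (_ + _).
  elim/combo_ind: y' / cy' {yE xy} => [|l q y [vq _ qv] IH]; first by rewrite amul0l.
  by have := rpath_target F v q; rewrite qv amulDl amulZl -IH => ->.
by move=> xi xiP xv; apply: laurent_char_neq0 cr xiP xv _ _ k0 cy'.
Qed.

End LaurentCharacter.

(** * Modules with bijective nonzero endomorphisms *)

Lemma inj_surj_bijective (T U : Type) (f : T -> U) :
  injective f -> (forall y, exists x, f x = y) -> bijective f.
Proof.
move=> fI fS; have [g gP] := choice fS.
by exists g => // x; apply: fI; rewrite gP.
Qed.

Section ModuleTheory.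
Variables (F : fieldType) (A : assocAlgType F).
Implicit Types M N P : rightModType A.

Lemma act0l M (a : A) : (0 : M) ◃ a = 0.
Proof. by have := actZl (0 : F) (0 : M) a; rewrite !scale0r. Qed.

Lemma act0r M (m : M) : m ◃ (0 : A) = 0.
Proof. by have := actZr (0 : F) m (0 : A); rewrite !scale0r. Qed.

Lemma act_suml M I (r : seq I) (f : I -> M) (a : A) :
  (\sum_(i <- r) f i) ◃ a = \sum_(i <- r) f i ◃ a.
Proof.
by apply: (big_morph (fun x => x ◃ a)) => [x y|]; rewrite ?actDl ?act0l.
Qed.

Section Homs.
Variables (M N : rightModType A) (f : M -> N).
Hypothesis fH : module_hom f.

Lemma module_homD x y : f (x + y) = f x + f y.
Proof. by have := fH.1 1 x y; rewrite !scale1r. Qed.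

Lemma module_hom0 : f 0 = 0.
Proof. by apply: (addrI (f 0)); rewrite -module_homD !addr0. Qed.

Lemma module_homZ k x : f (k *: x) = k *: f x.
Proof. by have := fH.1 k x 0; rewrite module_hom0 !addr0. Qed.

Lemma module_homB x y : f (x - y) = f x - f y.
Proof. by rewrite module_homD -scaleN1r module_homZ scaleN1r. Qed.

Lemma submodule_ker : submodule [set x | f x = 0]%classic.
Proof.
split=> /= [|x y fx fy|k x fx|x a fx].
- exact: module_hom0.
- by rewrite module_homD fx fy addr0.
- by rewrite module_homZ fx scaler0.
- by rewrite fH.2 fx act0l.
Qed.

Lemma submodule_im : submodule [set y | exists x, f x = y]%classic.
Proof.
split=> [|_ _ [x <-] [y <-]|k _ [x <-]|_ a [x <-]].
- by exists 0; apply: module_hom0.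
- by exists (x + y); apply: module_homD.
- by exists (k *: x); apply: module_homZ.
- by exists (x ◃ a); apply: fH.2.
Qed.

Lemma simple_hom_inj x : simple M -> f x <> 0 -> injective f.
Proof.
move=> [_ /(_ _ submodule_ker) sM] fx y z yz; case: sM => S.
  suff : [set x | f x = 0]%classic (y - z).
    by rewrite S => /eqP; rewrite subr_eq0 => /eqP.
  by rewrite /= module_homB yz subrr.
by case: fx; have : [set: M]%classic x by []; rewrite -S.
Qed.

Lemma simple_hom_surj x : simple N -> f x <> 0 -> forall y, exists z, f z = y.
Proof.
move=> [_ /(_ _ submodule_im) sN] fx y; case: sN => S.
  case: fx; have : [set y | exists x, f x = y]%classic (f x) by exists x.
  by rewrite S.
by have : [set: N]%classic y by []; rewrite -S.
Qed.

End Homs.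

Lemma module_hom_comp M N P (g : N -> P) (f : M -> N) :
  module_hom g -> module_hom f -> module_hom (g \o f).
Proof.
by move=> [gL gA] [fL fA]; split=> [k x y|m a]; rewrite /= ?fL ?gL ?fA ?gA.
Qed.

Lemma module_hom_can M N (f : M -> N) g : module_hom f -> cancel f g ->
  cancel g f -> module_hom g.
Proof.
move=> fH fK gK; split=> [k x y|m a]; apply: (can_inj fK).
  by rewrite (module_homD fH) (module_homZ fH) !gK.
by rewrite fH.2 !gK.
Qed.

Lemma mod_isomorphic_refl M : mod_isomorphic M M.
Proof. by exists id; split; [split|exists id]. Qed.

Lemma mod_isomorphic_sym M N : mod_isomorphic M N -> mod_isomorphic N M.
Proof.
move=> [f [fH [g fK gK]]]; exists g; split; last by exists f.
exact: module_hom_can gK.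
Qed.

Lemma mod_isomorphic_trans N M P :
  mod_isomorphic M N -> mod_isomorphic N P -> mod_isomorphic M P.
Proof.
move=> [f [fH fB]] [g [gH gB]]; exists (g \o f); split.
  exact: module_hom_comp.
exact: bij_comp.
Qed.

Lemma iso_simple M N : mod_isomorphic M N -> simple N -> simple M.
Proof.
move=> [f [fH [g fK gK]]] [N0 sN]; have gH := module_hom_can fH fK gK.
split=> [E|S [S0 SD SZ SA]].
  apply: N0; apply/seteqP; split=> [y _|//] /=.
  have : [set: M]%classic (g y) by [].
  by rewrite E /= => gy; rewrite -(gK y) gy (module_hom0 fH).
have : submodule [set y | S (g y)]%classic.
  split=> /= [|x y Sx Sy|k x Sx|x a Sx].
  - by rewrite (module_hom0 gH).
  - by rewrite (module_homD gH); apply: SD.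
  - by rewrite (module_homZ gH); apply: SZ.
  - by rewrite gH.2; apply: SA.
case/sN => E; [left|right]; apply/seteqP; split=> // x.
- move=> Sx; have : [set y | S (g y)]%classic (f x) by rewrite /= fK.
  by rewrite E /= => fx; rewrite -(fK x) fx (module_hom0 gH).
- by move=> ->.
- by move=> _; have : [set: N]%classic (f x) by []; rewrite -E /= fK.
Qed.

Lemma iso_projective M N : mod_isomorphic M N -> projective N -> projective M.
Proof.
move=> [f [fH [g fK gK]]] pN X Y s t sH sS tH.
have gH := module_hom_can fH fK gK.
have [h hH hE] := pN X Y s (t \o g) sH sS (module_hom_comp tH gH).
exists (h \o f); first exact: module_hom_comp.
by apply/funext => x; have := congr1 (@^~ (f x)) hE; rewrite /= fK.
Qed.

Lemma simple_neq0 M : simple M -> exists x : M, x <> 0.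
Proof.
move=> [M0 _]; apply/not_existsP => x0; apply: M0.
by apply/seteqP; split=> // x _; apply: contrapT => /x0.
Qed.

Lemma simple_finitely_generated M : simple M -> finitely_generated M.
Proof.
move=> sM; have [x x0] := simple_neq0 sM; exists [:: x] => S SM Sx.
case: (sM.2 S SM) => // E; case: x0.
by have : S x by [apply: Sx; rewrite mem_head]; rewrite E.
Qed.

(** This is what the proof takes from either simplicity or End M = F. *)
Definition schurian M : Prop := forall f : M -> M,
  module_hom f -> (forall x, f x = 0) \/ bijective f.

Lemma simple_schurian M : simple M -> schurian M.
Proof.
move=> sM f fH; have [f0|/existsNP[x fx]] := pselect (forall x, f x = 0).
  by left.
right; apply: inj_surj_bijective; first exact: simple_hom_inj fx.
exact: simple_hom_surj fx.
Qed.

Lemma endo_field_schurian M : alg_isomorphic (endo M) F^o ->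
  schurian M /\ exists x : M, x <> 0.
Proof.
move=> [phi [phiL phiM [psi phiK psiK]]].
have phi0 : phi 0 = 0.
  by apply: (addrI (phi 0)); have := phiL 1 0 0; rewrite !scale1r !addr0 => <-.
have idP : (id : M -> M) \in @endo_pred _ _ M by apply/asboolP; split.
(* Preservation of units is not part of [alg_isomorphic]; it follows by multiplying with the
   preimage of 1. *)
have phi1 : phi (Endo idP) = 1.
  have := phiM (Endo idP) (psi 1); rewrite psiK /amul /= mulr1 => <-.
  by rewrite -[RHS]psiK; congr phi; apply: val_inj.
split=> [f fH|].
  have fP : f \in @endo_pred _ _ M by apply/asboolP.
  have [p0|p0] := eqVneq (phi (Endo fP) : F) 0.
    left=> x; have /(congr1 (fun h : endo M => h x)) : Endo fP = 0.
      by apply: (can_inj phiK); rewrite p0 phi0.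
    by [].
  have inv (a b : endo M) : (phi a : F) * phi b = 1 -> cancel b a.
    move=> ab x; have := phiM a b; rewrite {2}/amul /= ab -phi1.
    by move=> /(can_inj phiK)/(congr1 (fun h : endo M => h x)).
  right; exists (psi (phi (Endo fP) : F)^-1).
    by apply: (inv _ (Endo fP)); rewrite psiK mulVf.
  by apply: (inv (Endo fP)); rewrite psiK mulfV.
apply/not_existsP => M0; have /eqP := oner_neq0 F; apply.
rewrite -phi1 -[RHS]phi0; congr phi; apply: val_inj; apply/funext => x /=.
by apply: contrapT => /M0 [].
Qed.

End ModuleTheory.

Section FreeModule.
Variables (F : fieldType) (G : digraph) (n : nat).
Local Notation L := (lpa F G).

(** The module L^n. It satisfies M = ML because finitely many elements of L have a common local
    unit. *)
Definition free_module := {ffun 'I_n -> L}.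

HB.instance Definition _ := GRing.Lmodule.on free_module.

Definition free_act (x : free_module) (a : L) : free_module :=
  [ffun i => x i ⋅ a].

Let free_actA x a b : free_act (free_act x a) b = free_act x (a ⋅ b).
Proof. by apply/ffunP => i; rewrite !ffunE amulA. Qed.

Let free_actDl x y a : free_act (x + y) a = free_act x a + free_act y a.
Proof. by apply/ffunP => i; rewrite !ffunE amulDl. Qed.

Let free_actDr x a b : free_act x (a + b) = free_act x a + free_act x b.
Proof. by apply/ffunP => i; rewrite !ffunE amulDr. Qed.

Let free_actZl k x a : free_act (k *: x) a = k *: free_act x a.
Proof. by apply/ffunP => i; rewrite !ffunE amulZl. Qed.

Let free_actZr k x a : free_act x (k *: a) = k *: free_act x a.
Proof. by apply/ffunP => i; rewrite !ffunE amulZr. Qed.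

Let free_unital (x : free_module) : exists r : seq (free_module * L),
  x = \sum_(p <- r) free_act p.1 p.2.
Proof.
have [eps epsP] := lpa_local_units (codom x).
exists [:: (x, eps)]; rewrite big_seq1; apply/ffunP => i.
by rewrite ffunE epsP // codom_f.
Qed.

HB.instance Definition _ := Lmodule_isRightModule.Build F L free_module
  free_actA free_actDl free_actDr free_actZl free_actZr free_unital.

End FreeModule.

(** * Projective modules and the summands vL *)

Section LpaModules.
Variables (F : fieldType) (G : digraph).
Local Notation L := (lpa F G).
Local Notation lv := (@lpa_vertex F G).
Local Notation rpath := (@rpath F G).
Local Notation gpath := (@gpath F G).
Implicit Types (u v w : vertex G) (p q c : seq (arrow G)) (x y : L).
Implicit Types M N : rightModType L.

Lemma module_local_unit M (m : M) : exists eps : L, m ◃ eps = m.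
Proof.
have [r ->] := act_unital m; have [eps epsP] := lpa_local_units (map snd r).
exists eps; rewrite act_suml big_seq [RHS]big_seq; apply: eq_bigr => p pr.
by rewrite actA epsP // map_f.
Qed.

(* Homomorphisms into L itself, which is not declared as a right module.      *)
Definition lpa_hom M (g : M -> L) : Prop :=
  linear g /\ forall m a, g (m ◃ a) = g m ⋅ a.

(** A finite generating family gives a surjection from L^n onto M. A splitting of it embeds M in
    L^n, so some coordinate of m is nonzero. *)
Lemma projective_coordinate M (m : M) : finitely_generated M -> projective M ->
  m <> 0 -> exists2 g : M -> L, lpa_hom g & g m <> 0.
Proof.
move=> [r rP] pM m0; pose n := size r.
pose phi (a : free_module F G n) : M := \sum_(i < n) r`_i ◃ a i.
have phiH : module_hom phi.
  split=> [k a b|a b]; rewrite /phi.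
    rewrite scaler_sumr -big_split; apply: eq_bigr => i _.
    by rewrite !ffunE actDr actZr.
  by rewrite act_suml; apply: eq_bigr => i _; rewrite ffunE actA.
have phiS : set_surj [set: free_module F G n]%classic [set: M]%classic phi.
  suff E : [set y | exists z, phi z = y]%classic = [set: M]%classic.
    move=> y _; have : [set: M]%classic y by [].
    by rewrite -E => -[z <-]; exists z.
  apply: rP => [|x xr]; first exact: submodule_im.
  have [eps epsE] := module_local_unit x.
  have xn : (index x r < n)%N by rewrite index_mem.
  (* A local unit of the generator x takes the place of 1 in the basis vector. *)
  exists [ffun i => if i == Ordinal xn then eps else 0].
  rewrite /phi (bigD1 (Ordinal xn)) //= ffunE eqxx nth_index // epsE.
  rewrite big1 ?addr0 // => i /negPf iN; rewrite ffunE iN; exact: act0r.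
have idH : module_hom (@id M) by split.
have [h hH hE] := pM _ _ phi id phiH phiS idH.
have [i hi] : exists i, h m i <> 0.
  apply/not_existsP => hm; apply: m0.
  have -> : m = phi (h m) by rewrite -[LHS]/(id m) hE.
  apply: big1 => i _; have -> : h m i = 0 by apply: contrapT => /hm.
  exact: act0r.
exists (fun m => h m i) => //; split=> [k x y|x a]; first by rewrite hH.1 !ffunE.
by rewrite hH.2 ffunE.
Qed.

Section VertexModuleTheory.
Variable v : vertex G.

Lemma vL_of_subproof x : lv v ⋅ x \in @vL_pred F G v.
Proof. by apply/asboolP; exists x. Qed.

Definition vL_of x : vL F v := VL (vL_of_subproof x).

Lemma vL_valK (z : vL F v) : vL_of (vL_val z) = z.
Proof.
apply: val_inj => /=; case: z => z zP /=; have /asboolP[a ->] := zP.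
by rewrite amulA lpa_vertex_idem.
Qed.

Lemma vL_valE (z : vL F v) : lv v ⋅ vL_val z = vL_val z.
Proof. by rewrite -[in RHS](vL_valK z). Qed.

Definition vL_gen : vL F v := vL_of (lv v).

Lemma vL_genE : vL_val vL_gen = lv v.
Proof. exact: lpa_vertex_idem. Qed.

Lemma vL_gen_act (z : vL F v) : vL_gen ◃ vL_val z = z.
Proof. by apply: val_inj; rewrite /= lpa_vertex_idem vL_valE. Qed.

Lemma vL_gen_neq0 : vL_gen <> 0.
Proof. by move/(congr1 (@vL_val F G v)); rewrite vL_genE => /lpa_vertex_neq0. Qed.

Lemma vL_hom M (m : M) : module_hom (fun z : vL F v => m ◃ vL_val z).
Proof. by split=> [k x y|x a] /=; rewrite ?actDr ?actZr ?actA. Qed.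

Lemma hom_to_vL M (g : M -> L) : lpa_hom g ->
  module_hom (fun m => vL_of (g m)).
Proof.
move=> [gL gA]; split=> [k x y|x a]; apply: val_inj => /=.
  by rewrite gL amulDr amulZr.
by rewrite gA amulA.
Qed.

(** A map out of vL is determined by the image of the idempotent v: lift f(v) to n and take z to n
    z. *)
Lemma vL_projective : projective (vL F v).
Proof.
move=> N P g f gH gS fH; have [n _ nE] := gS (f vL_gen) I.
exists (fun z : vL F v => n ◃ vL_val z); first exact: vL_hom.
apply/funext => z /=.
by rewrite gH.2 nE -fH.2 vL_gen_act.
Qed.

End VertexModuleTheory.

(* If the vertex v lies on the rigid cycle c, then v - c is a nonzero         *)
(* non-unit of the corner v L v, a Laurent polynomial ring.                   *)
Lemma schurian_rigid_cycle M v c (g : M -> L) (m : M) : schurian M -> lpa_hom g ->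
    rigid_cycle v c -> g m = lv v ⋅ g m -> g m = g m ⋅ lv v ->
    (forall xi, is_mpath xi -> (xi 0%N).1 = v -> laurent_char xi (g m) != 0) ->
  False.
Proof.
move=> sM [gL gA] cr yl yr ychar; set y := g m in yl yr ychar.
have [xi xiP xv] := mpath_exists v; have {}ychar := ychar _ xiP xv.
have charM := laurent_charM cr xiP xv.
have [[vc c0 cv] _] := cr; set C := rpath v c.
have Cl : C = lv v ⋅ C by rewrite vertex_rpath.
have Cr : C = C ⋅ lv v by rewrite -[in lv v]cv rpath_target.
pose d := lv v - C.
have dl : d = lv v ⋅ d by rewrite amulBr lpa_vertex_idem -Cl.
have dr : d = d ⋅ lv v by rewrite amulBl lpa_vertex_idem -Cr.
have dchar : laurent_char xi d = 1 - laurent_var F ^+ size c.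
  rewrite /laurent_char /corner_char lpa_actB ?laurent_var_neq0 //.
  rewrite -!/(corner_char _ _ _ _) -!/(laurent_char xi _).
  by rewrite (laurent_char_vertex _ xiP xv) (laurent_char_rpath _ cr xiP xv).
have d0 : laurent_char xi d != 0.
  by rewrite dchar one_sub_neq0 // lt0n size_eq0; apply/eqP.
(* Through g this becomes left multiplication by y d. It does not vanish at m, since y d y has
   nonzero Laurent polynomial; if m were in its image, 1 - t^|c| would be invertible among the
   Laurent polynomials. *)
pose phi m' := m ◃ (d ⋅ g m').
have phiH : module_hom phi.
  split=> [k a b|a b]; rewrite /phi; last by rewrite gA actA amulA.
  by rewrite gL !amulDr !amulZr actDr actZr.
have gphi m' : g (phi m') = y ⋅ (d ⋅ g m') by rewrite gA.
have ydl : d ⋅ y = lv v ⋅ (d ⋅ y) by rewrite amulA -dl.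
case: (sM phi phiH) => [/(_ m)|[psi _ /(_ m)]].
  move/(congr1 g); rewrite gphi; have -> : g 0 = 0.
    by have := gL (-1) 0 0; rewrite !scaleN1r !addNr.
  move/(congr1 (laurent_char xi)); rewrite charM // charM //.
  rewrite [RHS]/laurent_char /corner_char lpa_act0 ?laurent_var_neq0 // => /eqP.
  by rewrite !mulf_eq0 (negPf ychar) (negPf d0).
move/(congr1 g); rewrite gphi -/y; set m' := psi m => E.
have E' : y ⋅ (d ⋅ (lv v ⋅ (g m' ⋅ lv v))) = y.
  by rewrite (amulA d) -dr (amulA d) (amulA y) E -yr.
have /(congr1 (laurent_char xi)) := E'.
rewrite charM //; last by rewrite [RHS]amulA -dl.
rewrite charM //; last by rewrite [RHS]amulA lpa_vertex_idem.
rewrite -[RHS]mulr1 => /(mulfI ychar); rewrite dchar; exact: one_sub_not_inv.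
Qed.

(** Write w = a g0(m) b. The map z |-> m b z from wL to M has the left inverse m' |-> w a g0(m').
    The composite on M is an idempotent, nonzero because w <> 0, hence bijective. *)
Lemma schurian_vL M (m : M) : finitely_generated M -> projective M ->
  schurian M -> m <> 0 -> exists w, mod_isomorphic M (vL F w).
Proof.
move=> fM pM sM m0; have [g0 [g0L g0A] g0m] := projective_coordinate fM pM m0.
have shift a : lpa_hom (fun m' : M => a ⋅ g0 m').
  by split=> [k x y|x b]; rewrite ?g0L ?g0A ?amulDr ?amulZr ?amulA.
have [[w [a [b wE]]]|[v [c [y [cr [a [b yE]] yl yr ychar]]]]] := reduction g0m;
  last first.
  exfalso; apply: (schurian_rigid_cycle (m := m ◃ b) sM (shift a) cr).
  - by rewrite g0A amulA -yE.
  - by rewrite g0A amulA -yE.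
  - by rewrite g0A amulA -yE.
exists w; have gH := hom_to_vL w (shift a).
pose s (z : vL F w) := (m ◃ b) ◃ vL_val z.
have sH : module_hom s by apply: vL_hom.
pose g m' := vL_of w (a ⋅ g0 m').
have gs : cancel s g.
  move=> z; rewrite /g /s g0A g0A !amulA -wE -(vL_valK z); congr vL_of.
  by rewrite vL_valE vL_valK.
have [sg0|sgB] := sM (s \o g) (module_hom_comp sH gH).
  have [] := @vL_gen_neq0 w; rewrite -[LHS]gs -[X in s X]gs.
  by have /= -> := sg0 (s (vL_gen w)); apply: module_hom0.
exists g; split => //; exists s => // x.
by apply: (bij_inj sgB); rewrite /= gs.
Qed.

End LpaModules.

(** * Sinks and leaks *)

Section TameVertices.
Variable G : digraph.
Implicit Types (u v w : vertex G) (p q c : seq (arrow G)).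

Definition nobranch v : Prop := forall p e f, is_path v p ->
  source e = path_target v p -> source f = path_target v p -> e = f.

Definition tame v : Prop :=
  nobranch v /\ forall p c, is_path v p -> ~ closed_path (path_target v p) c.

Lemma nobranch_comparable v p q : nobranch v -> is_path v p -> is_path v q ->
  prefix p q \/ prefix q p.
Proof.
elim: p v q => [|e p IH] v [|f q] nv; rewrite ?prefix0s; [by left..|by right|].
move=> [ev ep] [fv fq]; have ef : e = f by apply: (nv [::]).
subst f; rewrite !prefix_cons !eqxx; apply: (IH (target e)) => //.
by move=> r g h gr; apply: (nv (e :: r)).
Qed.

Lemma sink_path v p : sink v -> is_path v p -> p = [::].
Proof. by case: p => // e p sv [/sv]. Qed.

Lemma sink_tame v : sink v -> tame v.
Proof.
move=> sv; split=> [p e f vp|p c vp].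
  by rewrite (sink_path sv vp) => /sv.
by rewrite (sink_path sv vp) => -[/(sink_path sv)].
Qed.

(** A branching would give two paths of one length, and a closed path would give two lengths with
    the same target. *)
Lemma leak_tame v : leak v -> tame v.
Proof.
move=> [P [PP Pinj]]; split=> [p e f vp ep fp|p c vp [pc c0 ct]].
  have E g : source g = path_target v p -> rcons p g = P (size p).+1.
    move=> gp; have [_ _ PU] := PP (size p).+1.
    by apply: PU; rewrite ?size_rcons // is_path_rcons.
  have := E e ep; rewrite -(E f fp) => /eqP.
  by rewrite eqseq_rcons => /andP[_ /eqP].
have E q : is_path v q -> q = P (size q).
  by move=> vq; have [_ _ PU] := PP (size q); apply: PU.
apply: (Pinj (size p) (size (p ++ c))).
  rewrite size_cat => /eqP; rewrite -{1}[size p]addn0 eqn_add2l.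
  by rewrite eq_sym size_eq0 => /eqP.
by rewrite -!E // ?path_target_cat ?ct //; apply/is_path_cat.
Qed.

(** The path of length n + 1 extends the only path of length n, so no path from a leak gets
    stuck. *)
Lemma leak_not_to_sink v w : leak v -> has_path v w -> ~ sink w.
Proof.
move=> [P [PP _]] [p vp <-] sp; have [vP sP _] := PP (size p).+1.
have [_ _ pU] := PP (size p).
have tP : take (size p) (P (size p).+1) = p.
  rewrite [RHS]pU //; apply: pU; last by rewrite size_takel // sP.
  by move: vP; rewrite -{1}(cat_take_drop (size p) (P _)) => /is_path_cat[].
move: vP; rewrite -(cat_take_drop (size p) (P _)) tP => /is_path_cat[_].
move/(sink_path sp)/(congr1 size); rewrite size_drop sP subSnn //.
Qed.

(** If no sink is reachable, every path extends, so all lengths occur. Paths from v are comparable,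
    hence unique in each length, and a repeated target would yield a closed path. *)
Lemma tame_sink_or_leak v : tame v ->
  exists2 w, has_path v w & sink w \/ leak w.
Proof.
move=> [nv av]; have [[w vw sw]|ns] := pselect (exists2 w, has_path v w & sink w).
  by exists w => //; left.
exists v; first by exists [::].
right; have path_ex n : exists p, is_path v p /\ size p = n.
  elim: n => [|n [p [vp sp]]]; first by exists [::].
  have [e ep] : exists e, source e = path_target v p.
    apply/not_existsP => np; apply: ns.
    by exists (path_target v p); [exists p|move=> e /np].
  by exists (rcons p e); rewrite is_path_rcons size_rcons sp.
have [P PP] := choice path_ex; exists P.
have PE n q : is_path v q -> size q = n -> q = P n.
  move=> vq sq; have [vP sP] := PP n; subst n.
  case: (nobranch_comparable nv vq vP) => /prefixP[r E].
    move: sP; rewrite E size_cat => /eqP; rewrite -{2}[size q]addn0 eqn_add2l.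
    by rewrite size_eq0 => /eqP->; rewrite cats0.
  have := congr1 size E; rewrite size_cat sP => /eqP.
  rewrite -{1}[size q]addn0 eqn_add2l eq_sym size_eq0 => /eqP r0.
  by rewrite {1}E r0 cats0.
split=> [n|]; first by have [vP sP] := PP n; split => // q; apply: PE.
suff H m n : (m < n)%N -> path_target v (P m) <> path_target v (P n).
  by move=> m n /eqP; rewrite neq_ltn => /orP[/H//|/H/nesym].
move=> mn tmn; have [[vm sm] [vn sn]] := (PP m, PP n).
have E : P n = P m ++ drop m (P n).
  rewrite -{1}(cat_take_drop m (P n)); congr (_ ++ _); apply: PE.
    by move: vn; rewrite -{1}(cat_take_drop m (P n)) => /is_path_cat[].
  by rewrite size_takel // sn ltnW.
apply: (av (P m) (drop m (P n)) vm); split.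
- by move: vn; rewrite {1}E => /is_path_cat[].
- by move/(congr1 size)/eqP; rewrite size_drop sn /= subn_eq0 leqNgt mn.
- by rewrite -path_target_cat -E.
Qed.

End TameVertices.

(** * The modules vL at tame vertices *)

Section TameModules.
Variables (F : fieldType) (G : digraph).
Local Notation L := (lpa F G).
Local Notation lv := (@lpa_vertex F G).
Local Notation la := (@lpa_arrow F G).
Local Notation lg := (@lpa_ghost F G).
Local Notation rpath := (@rpath F G).
Local Notation gpath := (@gpath F G).
Implicit Types (u v w : vertex G) (p q c : seq (arrow G)) (x y : L).
Implicit Types M N : rightModType L.

(** Where e is the only arrow leaving a vertex, (CK2) says that e e^* is that vertex. *)
Lemma nobranch_rpath_gpath v p : nobranch v -> is_path v p ->
  rpath v p ⋅ gpath v p = lv v.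
Proof.
elim: p v => [|e p IH] v nv /=; first by rewrite lpa_vertex_idem.
move=> [ev ep]; rewrite amulA -(amulA (la e)) IH //; last first.
  by move=> q f g fq; apply: (nv (e :: q)).
rewrite -amulA target_ghost (@vertex_CK2 F G v [:: e]) ?big_seq1 // => f.
rewrite inE; split=> [/eqP->//|fv]; apply/eqP.
exact: (nv [::]).
Qed.

(** Left multiplications by p^* and by p are mutually inverse, since p p^* = v and p^* p = w. *)
Lemma nobranch_iso v w : nobranch v -> has_path v w ->
  mod_isomorphic (vL F v) (vL F w).
Proof.
move=> nv [p vp <-]; set w' := path_target v p.
pose f (z : vL F v) := vL_of w' (gpath v p ⋅ vL_val z).
exists f; split.
  apply: (hom_to_vL (M := vL F v) w' (g := fun z => gpath v p ⋅ vL_val z)).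
  by split=> [k x y|x a] /=; rewrite ?amulDr ?amulZr ?amulA.
exists (fun z => vL_of v (rpath v p ⋅ vL_val z)) => z; apply: val_inj => /=.
  rewrite (amulA _ (lv w')) rpath_target !amulA -(amulA (lv v)).
  by rewrite nobranch_rpath_gpath // lpa_vertex_idem vL_valE.
rewrite (amulA (lv v)) vertex_rpath // !amulA -(amulA (lv w')).
by rewrite gpath_rpath // lpa_vertex_idem vL_valE.
Qed.

Definition gmono (m : vertex G * seq (arrow G)) : L := gpath m.1 m.2.

Lemma gpath_gmono v p y : is_path v p -> combo gmono (is_path_to v) y ->
  combo gmono (is_path_to (path_target v p)) (gpath v p ⋅ y).
Proof.
move=> vp; apply: combo_map (linear_amull _) _ _ => -[u q] [/= uq qv].
have uqp : is_path u (q ++ p) by apply/is_path_cat; rewrite qv.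
have -> : gpath v p ⋅ gmono (u, q) = gmono (u, q ++ p).
  by rewrite /gmono /= gpath_cat // qv.
by apply: combo1; split => //=; rewrite path_target_cat qv.
Qed.

(** The paths p in the monomials p q^* of x are comparable, and a shorter one a is rewritten as (ab)
    b^*, so that a longest one can be factored out. *)
Lemma nobranch_corner_form v x : nobranch v -> x = lv v ⋅ x ->
  exists p y, [/\ is_path v p, combo gmono (is_path_to (path_target v p)) y
    & x = rpath v p ⋅ y].
Proof.
move=> nv xE; have {xE} : combo (@mono F G)
    (fun m => is_mono m /\ m.1.1 = v) x.
  rewrite xE; apply: combo_map (linear_amull _) _ _ (lpa_combo x).
  move=> m [mp mq mt]; rewrite /mono amulA.
  have [mv|/eqP mv] := eqVneq m.1.1 v.
    by rewrite -mv vertex_rpath //; apply: (@combo1 _ _ _ (@mono F G) _ m).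
  by rewrite vertex_rpath0 ?amul0l; [apply: combo0|exact: mp|apply/nesym].
elim/combo_ind => [|k [[v' q] [u r]] x' [[/= vq ur qr] v'v] [p [y [vp cy ->]]]].
  by exists [::], 0; split; rewrite ?amul0r //; apply: combo0.
rewrite /= in v'v; subst v'; rewrite /mono /=.
have cr : combo gmono (is_path_to (path_target v q)) (gpath u r).
  by apply: (@combo1 _ _ _ gmono _ (u, r)).
have extend a b : is_path v (a ++ b) ->
    rpath v a = rpath v (a ++ b) ⋅ gpath (path_target v a) b.
  move=> vab; have := vab; rewrite is_path_cat => -[va ab].
  rewrite rpath_cat // -amulA nobranch_rpath_gpath ?rpath_target //.
  move=> s e f asP; rewrite -path_target_cat; apply: nv.
  exact/is_path_cat.
case: (nobranch_comparable nv vq vp) => /prefixP[s E]; subst.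
  exists (q ++ s), (k *: (gpath (path_target v q) s ⋅ gpath u r) + y).
  split => //; last by rewrite amulDr amulZr amulA -extend.
  apply: comboD => //; apply: comboZ; rewrite path_target_cat.
  by apply: gpath_gmono cr; move: vp; rewrite is_path_cat => -[].
exists (p ++ s), (k *: gpath u r + gpath (path_target v p) s ⋅ y).
split => //; last by rewrite amulDr amulZr amulA -extend.
apply: comboD; first exact: comboZ.
rewrite path_target_cat; apply: gpath_gmono cy.
by move: vq; rewrite is_path_cat => -[].
Qed.

(** Let x = p y and let q^* be a term of y with coefficient c. Then y q = c t(p): if another term
    did not vanish, one of the two paths would extend the other by a closed path at t(p). So x q p^*
    = c p p^* = c v. *)
Lemma tame_vertex_reached v x : tame v -> x = lv v ⋅ x -> x <> 0 ->
  exists b, x ⋅ b = lv v.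
Proof.
move=> [nv av] xE x0; have [p [y [vp cy xpy]]] := nobranch_corner_form nv xE.
have [s [c [us sP yE]]] := combo_uniq cy; set t := path_target v p in sP.
have [m ms] : exists m, m \in s.
  case: s yE {us sP} => [|m s _]; last by exists m; rewrite mem_head.
  by move=> yE; case: x0; rewrite xpy yE big_nil amul0r.
have [[mp mt] cm] := sP _ ms.
exists ((c m)^-1 *: (rpath m.1 m.2 ⋅ gpath v p)).
have -> : x ⋅ ((c m)^-1 *: (rpath m.1 m.2 ⋅ gpath v p)) =
    (c m)^-1 *: (rpath v p ⋅ (y ⋅ rpath m.1 m.2) ⋅ gpath v p).
  by rewrite amulZr xpy !amulA.
suff -> : y ⋅ rpath m.1 m.2 = c m *: lv t.
  rewrite amulZr amulZl scalerA mulVf // scale1r rpath_target.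
  exact: nobranch_rpath_gpath.
rewrite yE amul_suml (bigD1_seq m) //= amulZl gpath_rpath // mt.
rewrite big_seq_cond big1 ?addr0 // => -[u q] /andP[qs qm].
have [[/= uq qt] _] := sP _ qs; rewrite amulZl /gmono /=.
case: m ms mp mt qm {cm} => [u' q'] /= ms uq' qt' qm.
rewrite gpath_rpath_cases //; case: eqVneq => [uu /=|_]; last by rewrite scaler0.
subst u'; have noclosed r : is_path t r -> path_target t r = t -> r = [::].
  move=> tr rt; apply: contrapT => r0; apply: (av p r vp).
  by split.
case: ifP => [/prefixP[r E]|_].
  case/eqP: qm; subst q'; move: uq' qt'; rewrite is_path_cat path_target_cat qt.
  by move=> [_ tr] /(noclosed _ tr)->; rewrite cats0.
case: ifP => [/prefixP[r E]|_]; last by rewrite scaler0.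
case/eqP: qm; subst q; move: uq qt; rewrite is_path_cat path_target_cat qt'.
by move=> [_ tr] /(noclosed _ tr)->; rewrite cats0.
Qed.

(** In x = p y v only the ghosts q^* with q from v survive. Such a q is comparable with p and has
    the same target, so q = p for lack of closed paths, and p p^* = v. *)
Lemma tame_corner v x : tame v -> x = lv v ⋅ x -> x = x ⋅ lv v ->
  exists k : F, x = k *: lv v.
Proof.
move=> [nv av] xl xr; have [p [y [vp cy xpy]]] := nobranch_corner_form nv xl.
suff [k yv] : exists k : F, y ⋅ lv v = k *: gpath v p.
  exists k; rewrite xr xpy -amulA yv amulZr nobranch_rpath_gpath //.
elim/combo_ind: y / cy {xpy} => [|k [u q] y [/= uq qt] [l IH]].
  by exists 0; rewrite scale0r amul0l.
rewrite amulDl amulZl IH /gmono /=.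
have [uv|/eqP uv] := eqVneq u v; last first.
  by exists l; rewrite gpath_vertex0 // scaler0 add0r.
subst u; exists (k + l); rewrite gpath_vertex // scalerDl.
suff -> : q = p by [].
case: (nobranch_comparable nv uq vp) => /prefixP[r E]; subst.
  have [->|/eqP r0] := eqVneq r [::]; first by rewrite cats0.
  case: (av q r uq); split=> //.
    by move: vp; rewrite is_path_cat => -[].
  by rewrite -path_target_cat -qt.
have [->|/eqP r0] := eqVneq r [::]; first by rewrite cats0.
case: (av p r vp); split=> //.
  by move: uq; rewrite is_path_cat => -[].
by rewrite -path_target_cat.
Qed.

Lemma tame_simple v : tame v -> simple (vL F v).
Proof.
move=> tv; split=> [E|S [S0 SD SZ SA]].
  have : [set: vL F v]%classic (vL_gen F v) by [].
  by rewrite E => /vL_gen_neq0.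
have [S00|/existsNP[z zS]] := pselect (forall z, S z -> z = 0).
  by left; apply/seteqP; split=> [z /S00|_ ->].
right; apply/seteqP; split=> // y _.
have [Sz z0] : S z /\ z <> 0 by split; [apply: contrapT|] => h; apply: zS.
have [b zb] : exists b, vL_val z ⋅ b = lv v.
  apply: tame_vertex_reached tv _ _; first by rewrite vL_valE.
  by move=> z0'; apply: z0; apply: val_inj.
rewrite -(vL_gen_act y); apply: (SA).
have -> : vL_gen F v = z ◃ b by apply: val_inj; rewrite /= zb lpa_vertex_idem.
exact: SA.
Qed.

Lemma scalar_endo_field M : (exists m : M, m <> 0) ->
    (forall f : M -> M, module_hom f -> exists k : F, forall m, f m = k *: m) ->
  alg_isomorphic (endo M) F^o.
Proof.
move=> [m m0] sc.
have [phi phiE] : exists phi : endo M -> F^o,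
    forall (f : endo M) m, f m = (phi f : F) *: m.
  have /choice[phi phiE] : forall f : endo M, exists k : F, forall m, f m = k *: m.
    by move=> f; apply: sc; apply: endo_hom.
  by exists phi.
have scI (k l : F) : k *: m = l *: m -> k = l.
  move/eqP; rewrite -subr_eq0 -scalerBl scaler_eq0 subr_eq0.
  by move=> /orP[/eqP//|/eqP].
exists phi; split.
- by move=> k f g; apply: scI; rewrite -phiE scalerDl -scalerA -!phiE.
- by move=> f g; apply: scI; rewrite -scalerA -!phiE.
apply: inj_surj_bijective => [f g fg|k].
  by apply: val_inj; apply/funext => x /=; rewrite !phiE fg.
have kP : (fun x : M => (k : F) *: x) \in @endo_pred _ _ M.
  apply/asboolP; split=> [l x y|x a]; last by rewrite actZl.
  by rewrite scalerDr !scalerA mulrC.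
by exists (Endo kP); apply: scI; rewrite -phiE.
Qed.

(** An endomorphism of vL sends v into vLv = F v. *)
Lemma tame_endo M v : tame v -> mod_isomorphic M (vL F v) ->
  alg_isomorphic (endo M) F^o.
Proof.
move=> tv [h [hH [g hK gK]]]; have gH := module_hom_can hH hK gK.
apply: scalar_endo_field => [|f fH].
  exists (g (vL_gen F v)) => /(congr1 h); rewrite gK (module_hom0 hH).
  exact: vL_gen_neq0.
pose z := h (f (g (vL_gen F v))).
have [k zk] : exists k : F, vL_val z = k *: lv v.
  apply: tame_corner tv _ _; first by rewrite vL_valE.
  transitivity (vL_val (z ◃ lv v)); last by [].
  congr vL_val; rewrite /z -hH.2 -fH.2 -gH.2; congr (h (f (g _))).
  by apply: val_inj; rewrite /= !lpa_vertex_idem.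
exists k => m; rewrite -[m in LHS]hK -[h m]vL_gen_act.
rewrite gH.2 fH.2 -[f _]hK -gH.2 -/z.
have -> : z ◃ vL_val (h m) = k *: h m.
  by apply: val_inj; rewrite /= zk amulZl vL_valE.
by rewrite (module_homZ gH) hK.
Qed.

(** Left multiplication by a nonzero element of wLw is injective on wL. If p could be continued by e
    <> f, the idempotent (pe) (pe)^* would kill pf. A closed path reachable from w would then have
    no exit, and [schurian_rigid_cycle] applies to z |-> p^* z, which takes p to a vertex on the
    cycle. *)
Lemma schurian_vL_tame w : schurian (vL F w) -> tame w.
Proof.
move=> sw.
have cancel_corner x y : x = lv w ⋅ x -> x <> 0 -> y = lv w ⋅ y ->
    x ⋅ y = 0 -> x = x ⋅ lv w -> y = 0.
  move=> xl x0 yl xy xr; pose f (z : vL F w) := vL_of w (x ⋅ vL_val z).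
  have fH : module_hom f.
    apply: (hom_to_vL (M := vL F w) w (g := fun z => x ⋅ vL_val z)).
    by split=> [k a b|a b] /=; rewrite ?amulDr ?amulZr ?amulA.
  case: (sw f fH) => [/(_ (vL_gen F w))/(congr1 (@vL_val F G w))|/bij_inj fI].
    by rewrite /= lpa_vertex_idem -xr -xl.
  have /(congr1 (@vL_val F G w)) : vL_of w y = 0; last by rewrite /= -yl.
  apply: fI; rewrite (module_hom0 fH); apply: val_inj.
  by rewrite /= -yl xy amul0r.
have nw : nobranch w.
  move=> p e f wp ep fp; apply: contrapT => ef.
  have we : is_path w (rcons p e) by rewrite is_path_rcons.
  have wf : is_path w (rcons p f) by rewrite is_path_rcons.
  have nz q : is_path w q -> rpath w q <> 0.
    move=> wq q0; apply: (@lpa_vertex_neq0 F G (path_target w q)).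
    by rewrite -gpath_rpath // q0 amul0r.
  apply: (nz _ wf).
  apply: (cancel_corner (rpath w (rcons p e) ⋅ gpath w (rcons p e))).
  - by rewrite amulA vertex_rpath.
  - move=> /(congr1 (fun x => x ⋅ rpath w (rcons p e))).
    by rewrite -amulA gpath_rpath // rpath_target amul0l; apply: nz.
  - by rewrite vertex_rpath.
  - rewrite -amulA gpath_rpath_cases // eqxx /=.
    have npre a b : a <> b -> prefix (rcons p a) (rcons p b) = false.
      move=> ab; apply/negP => /prefixP[r E].
      have := congr1 size E; rewrite size_cat !size_rcons => /eqP.
      rewrite -{1}[(size p).+1]addn0 eqn_add2l eq_sym size_eq0 => /eqP r0.
      move: E; rewrite r0 cats0 => /eqP; rewrite eqseq_rcons => /andP[_ /eqP].
      exact/nesym.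
    by rewrite !npre ?amul0r //; apply/nesym.
  - by rewrite -amulA gpath_vertex.
split=> // p c wp cP; set u := path_target w p in cP.
have cr : rigid_cycle u c.
  split=> // e f ec fe; case: (cP) => uc _ _.
  case/splitPr: ec uc => a b /is_path_cat[ua /= [ea _]].
  apply: (nw (p ++ a)); rewrite ?path_target_cat -/u -?ea //.
  exact/is_path_cat.
pose g (z : vL F w) := gpath w p ⋅ vL_val z.
have gH : lpa_hom g by split=> [k x y|x a]; rewrite /g /= ?amulDr ?amulZr ?amulA.
pose m := vL_of w (rpath w p).
have gm : g m = lv u.
  by rewrite /g /= vertex_rpath // gpath_rpath.
apply: (schurian_rigid_cycle (m := m) sw gH cr); rewrite ?gm ?lpa_vertex_idem //.
move=> xi xiP xu; rewrite (laurent_char_vertex _ xiP xu); exact: oner_neq0.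
Qed.

(** A monomial p q^* that survives in vLu has p from v and q from u, and these paths end at the same
    vertex. *)
Lemma vL_support v u : module_support (vL F v) u -> leak_equiv v u.
Proof.
move=> [z zu]; apply: contrapT => vu; apply: zu; apply: val_inj => /=.
rewrite -vL_valE; move: (vL_val z) => x.
elim/combo_ind: x / (lpa_combo x) => [|k [[v' p] [u' q]] x [/= vp uq pq] IH].
  by rewrite amul0r amul0l.
rewrite amulDr amulDl IH addr0 amulZr amulZl /mono /=.
have [vv|/eqP vv] := eqVneq v v'; last first.
  by rewrite (amulA (lv v)) vertex_rpath0 // !amul0l scaler0.
have [uu|/eqP uu] := eqVneq u' u; last first.
  by rewrite -!amulA gpath_vertex0 // !amul0r scaler0.
subst; case: vu; exists (path_target u q); last by exists q.
by exists p.
Qed.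

Lemma iso_support M N u :
  mod_isomorphic M N -> module_support M u -> module_support N u.
Proof.
move=> [f [fH [g fK gK]]] [m mu]; exists (f m); rewrite -fH.2 => E.
by apply: mu; apply: (can_inj fK); rewrite E (module_hom0 fH).
Qed.

Lemma vL_support_self v : module_support (vL F v) v.
Proof.
exists (vL_gen F v) => /(congr1 (@vL_val F G v)).
by rewrite /= !lpa_vertex_idem; apply: lpa_vertex_neq0.
Qed.

(** If mv <> 0, then z |-> m z is a nonzero map between the simple modules vL and M. *)
Lemma simple_support_iso M v : tame v -> simple M -> module_support M v ->
  mod_isomorphic M (vL F v).
Proof.
move=> tv sM [m mv]; apply: mod_isomorphic_sym.
have fH := vL_hom v m.
have f0 : m ◃ vL_val (vL_gen F v) <> 0 by rewrite vL_genE.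
exists (fun z : vL F v => m ◃ vL_val z); split => //.
apply: inj_surj_bijective.
  exact: (simple_hom_inj fH (tame_simple tv) f0).
exact: (simple_hom_surj fH sM f0).
Qed.

(** This also shows that having a common successor is transitive on tame vertices. *)
Lemma leak_equiv_iso u v : tame u -> tame v ->
  leak_equiv u v <-> mod_isomorphic (vL F u) (vL F v).
Proof.
move=> [nu _] [nv _]; split=> [[w uw vw]|uv].
  apply: (mod_isomorphic_trans (nobranch_iso nu uw)).
  exact/mod_isomorphic_sym/nobranch_iso.
apply: vL_support; apply: iso_support (vL_support_self v).
exact: mod_isomorphic_sym.
Qed.

Lemma sink_or_leak_tame v : sink v \/ leak v -> tame v.
Proof. by move=> [/sink_tame|/leak_tame]. Qed.

Lemma schurian_sink_or_leak M (m : M) : finitely_generated M -> projective M ->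
    schurian M -> m <> 0 ->
  exists2 v, sink v \/ leak v & mod_isomorphic M (vL F v).
Proof.
move=> fM pM sM m0; have [w Mw] := schurian_vL fM pM sM m0.
have sw : schurian (vL F w).
  case: Mw => h [hH [g hK gK]] f fH; have gH := module_hom_can hH hK gK.
  have [z|fB] := sM (g \o (f \o h)) (module_hom_comp gH (module_hom_comp fH hH)).
    left=> x; rewrite -[x]gK; apply: (can_inj gK).
    by rewrite (module_hom0 gH); apply: z.
  right; have hB : bijective h by exists g.
  have gB : bijective g by exists h.
  apply: (eq_bij (bij_comp hB (bij_comp fB gB))) => x /=.
  by rewrite !gK.
have tw := schurian_vL_tame sw; have [v wv vP] := tame_sink_or_leak tw.
exists v => //; apply: mod_isomorphic_trans Mw _; exact: nobranch_iso tw.1 wv.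
Qed.

End TameModules.

Local Open Scope classical_set_scope.

(** * Simple projective modules *)

Section SimpleProjective.
Variables (F : fieldType) (G : digraph).
Local Notation L := (lpa F G).
Implicit Types (M N : rightModType L) (v u : vertex G) (C : set (vertex G)).

Lemma vL_simple_projective v : sink v \/ leak v ->
  simple (vL F v) /\ projective (vL F v).
Proof.
by move=> /sink_or_leak_tame tv; split; [apply: tame_simple|apply: vL_projective].
Qed.

Lemma simple_projective_equiv M :
  [<-> simple M /\ projective M;
       exists2 v, sink v \/ leak v & mod_isomorphic M (vL F v);
       simple M /\ exists2 v, sink v \/ leak v & module_support M v;
       [/\ finitely_generated M, projective M
         & alg_isomorphic (endo M) F^o]].
Proof.
tfae.
- move=> [sM pM]; have [m m0] := simple_neq0 sM.
  apply: schurian_sink_or_leak m0 => //; last exact: simple_schurian.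
  exact: simple_finitely_generated.
- move=> [v vP Mv]; have tv := sink_or_leak_tame vP; split.
    exact: iso_simple Mv (tame_simple F tv).
  exists v => //; apply: iso_support (vL_support_self F v).
  exact: mod_isomorphic_sym.
- move=> [sM [v /sink_or_leak_tame tv Mv]].
  have Mi := simple_support_iso tv sM Mv; split.
  + exact: simple_finitely_generated.
  + exact: iso_projective Mi (@vL_projective F G v).
  + exact: tame_endo tv Mi.
move=> [fM pM eM]; have [sM [m m0]] := endo_field_schurian eM.
have [v vP Mv] := schurian_sink_or_leak fM pM sM m0.
by split=> //; apply: iso_simple Mv (tame_simple F (sink_or_leak_tame vP)).
Qed.

Lemma simple_projective_iso M : simple M -> projective M ->
  exists2 v, sink v \/ leak v & mod_isomorphic M (vL F v).
Proof.
move=> sM pM.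
by have [+ _] := simple_projective_equiv M 0%N 1%N; apply; split.
Qed.

Lemma iso_support_equiv M v u : tame v -> tame u -> simple M ->
  mod_isomorphic M (vL F v) -> module_support M u <-> leak_equiv u v.
Proof.
move=> tv tu sM Mv; rewrite (leak_equiv_iso F tu tv); split=> [Mu|uv].
  apply: mod_isomorphic_trans Mv; apply: mod_isomorphic_sym.
  exact: simple_support_iso.
apply: iso_support (vL_support_self F u).
exact: mod_isomorphic_trans uv (mod_isomorphic_sym Mv).
Qed.

Lemma leak_equiv_sink u v : sink v -> leak_equiv u v -> has_path u v.
Proof. by move=> sv [w + [p /(sink_path sv)->]] => /[swap] <-. Qed.

Lemma sink_leak_equiv u v : sink u -> sink v -> leak_equiv u v -> u = v.
Proof.
by move=> su sv /(leak_equiv_sink sv)[p /(sink_path su)-> <-].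
Qed.

Lemma leak_equiv_refl v : leak_equiv v v.
Proof. by exists v; exists [::]. Qed.

Lemma leak_classP C u : leak_class C -> C u -> leak u /\
  C = [set w | leak w /\ leak_equiv w u].
Proof.
move=> [v lv ->] [lu uv]; split=> //; have tv := leak_tame lv.
have {}uv := (leak_equiv_iso F (leak_tame lu) tv).1 uv.
apply/seteqP; split=> w [lw] /(leak_equiv_iso F (leak_tame lw)) wv; split=> //.
  apply/(leak_equiv_iso F (leak_tame lw) (leak_tame lu)).
  exact: mod_isomorphic_trans (wv tv) (mod_isomorphic_sym uv).
apply/(leak_equiv_iso F (leak_tame lw) tv).
exact: mod_isomorphic_trans (wv (leak_tame lu)) uv.
Qed.

Lemma leak_class_neq0 C : leak_class C -> exists u, C u.
Proof. by move=> [v lv ->]; exists v; split=> //; apply: leak_equiv_refl. Qed.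

(** The relation between a module and its label; the sum type allows sinks and classes of leaks to
    be compared in one uniqueness statement. *)
Definition supports M (x : vertex G + set (vertex G)) : Prop :=
  match x with
  | inl v => sink v /\ module_support M v
  | inr C => leak_class C /\ C `<=` module_support M
  end.

(** Any two tame vertices in the support have a common successor. For two sinks this means equality,
    a leak reaches no sink, and two leaks lie in the same class. *)
Lemma supports_uniq M x y : simple M -> projective M ->
  supports M x -> supports M y -> x = y.
Proof.
move=> sM pM; have [w wP Mw] := simple_projective_iso sM pM.
have tw := sink_or_leak_tame wP.
have eqM u v : tame u -> tame v -> module_support M u -> module_support M v ->
    leak_equiv u v.
  move=> tu tv Mu Mv; have Mv' := simple_support_iso tv sM Mv.
  exact/(iso_support_equiv tv tu sM Mv').
have mixed v C : sink v -> module_support M v -> leak_class C ->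
    C `<=` module_support M -> False.
  move=> sv Mv cC CM; have [u Cu] := leak_class_neq0 cC.
  have [lu _] := leak_classP cC Cu.
  have := eqM u v (leak_tame lu) (sink_tame sv) (CM _ Cu) Mv.
  by move=> /(leak_equiv_sink sv)/(leak_not_to_sink lu).
case: x y => [v|C] [v'|C'] /= [H1 H2] [H3 H4].
- congr inl; apply: sink_leak_equiv => //.
  by apply: eqM => //; apply: sink_tame.
- by case: (mixed v C').
- by case: (mixed v' C).
have [[u Cu] [u' Cu']] := (leak_class_neq0 H1, leak_class_neq0 H3).
have [[lu _] [lu' E']] := (leak_classP H1 Cu, leak_classP H3 Cu').
have : C' u.
  rewrite E'; split=> //.
  by apply: eqM; [exact: leak_tame|exact: leak_tame|exact: H2|exact: H4].
move=> C'u; have [_ ->] := leak_classP H1 Cu.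
by have [_ ->] := leak_classP H3 C'u.
Qed.

Lemma supports_exists M : simple M -> projective M -> exists x, supports M x.
Proof.
move=> sM pM; have [v vP Mv] := simple_projective_iso sM pM.
have tv := sink_or_leak_tame vP.
case: vP => [sv|lv].
  exists (inl v); split=> //.
  exact/(iso_support_equiv tv tv sM Mv)/leak_equiv_refl.
exists (inr [set u | leak u /\ leak_equiv u v]); split; first by exists v.
by move=> u [/leak_tame tu uv]; apply/(iso_support_equiv tv tu sM Mv).
Qed.

Lemma supports_vL M v : tame v -> mod_isomorphic M (vL F v) ->
  module_support M v.
Proof.
move=> tv Mv; apply: iso_support (vL_support_self F v).
exact: mod_isomorphic_sym.
Qed.

Lemma supports_iso M N x : simple M -> simple N ->
  supports M x -> supports N x -> mod_isomorphic M N.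
Proof.
move=> sM sN Mx Nx; have [v [tv Mv Nv]] : exists v,
    [/\ tame v, module_support M v & module_support N v].
  case: x Mx Nx => [v|C] [H1 H2] [_ H3].
    by exists v; split=> //; apply: sink_tame.
  have [u Cu] := leak_class_neq0 H1; exists u.
  by split; [apply: leak_tame (leak_classP H1 Cu).1|apply: H2|apply: H3].
apply: mod_isomorphic_trans (simple_support_iso tv sM Mv) _.
exact/mod_isomorphic_sym/simple_support_iso.
Qed.

Lemma iso_supports M N x : mod_isomorphic M N -> supports M x -> supports N x.
Proof.
move=> MN; case: x => [v|C] [H1 H2]; split=> //; first exact: iso_support MN H2.
by move=> u /H2; apply: iso_support.
Qed.

(** The default [inr set0] is not taken on classes of simple projective modules, since these have a
    label by [supports_exists]. *)
Definition class_label (P : rightModType L -> Prop) :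
    vertex G + set (vertex G) :=
  xget (inr set0) [set x | exists M, [/\ simple M, projective M, P = iso_class M
    & supports M x]].

Lemma class_labelP M x : simple M -> projective M ->
  class_label (iso_class M) = x <-> supports M x.
Proof.
move=> sM pM; have [y My] := supports_exists sM pM.
suff -> : class_label (iso_class M) = y.
  by split=> [<-//|Mx]; apply: supports_uniq My Mx.
rewrite /class_label; set S := [set _ | _].
have : S (xget (inr set0) S) by apply: xgetPex; exists y, M.
move=> [N [sN pN MN Nx]]; apply: (supports_uniq sM pM) My => //.
apply: iso_supports Nx; suff : iso_class M N by [].
by rewrite MN; apply: mod_isomorphic_refl.
Qed.

Lemma iso_class_eq M N : mod_isomorphic M N -> iso_class M = iso_class N.
Proof.
move=> MN; apply/funext => X; apply/propext; split=> XM.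
  exact: mod_isomorphic_trans XM MN.
exact: mod_isomorphic_trans XM (mod_isomorphic_sym MN).
Qed.

(** Modules with the same label share a tame vertex v in their supports, so both are isomorphic to
    vL. Conversely, vL realizes the label given by a sink v or by the class of a leak v. *)
Lemma class_label_one_to_one :
  one_to_one_on (@simple_projective_class F G) (@sinks_and_leak_classes G)
    class_label.
Proof.
split.
- move=> _ [M [sM pM ->]].
  have : supports M (class_label (iso_class M)).
    exact: (class_labelP _ sM pM).1.
  by case: (class_label _) => [v|C] [H _]; [left; exists v|right; exists C].
- move=> _ _ [M [sM pM ->]] [N [sN pN ->]] E; apply: iso_class_eq.
  have [x Mx] := supports_exists sM pM; apply: (supports_iso sM sN Mx).
  by apply/(class_labelP _ sN pN); rewrite -E; apply/(class_labelP _ sM pM).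
move=> x xP; have [v [vP vx]] : exists v, (sink v \/ leak v) /\
    (forall M, mod_isomorphic M (vL F v) -> simple M -> supports M x).
  case: xP => [[v sv <-]|[C [v lv CE] <-]]; exists v.
    split=> [|M Mv sM]; first by left.
    by split=> //; apply: supports_vL => //; apply: sink_tame.
  split=> [|M Mv sM]; first by right.
  split; first by exists v.
  have tv := leak_tame lv; rewrite CE => u [lu uv].
  exact/(iso_support_equiv tv (leak_tame lu) sM Mv).
have [sv pv] := vL_simple_projective vP; exists (iso_class (vL F v)).
  by exists (vL F v).
by apply/class_labelP => //; apply: vx => //; apply: mod_isomorphic_refl.
Qed.

End SimpleProjective.

Theorem proposition19 (F : fieldType) (G : digraph) :
  (forall M : rightModType (lpa F G),
    [<-> simple M /\ projective M;
         exists2 v : vertex G, sink v \/ leak v & mod_isomorphic M (vL F v);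
         simple M /\ exists2 v : vertex G, sink v \/ leak v & module_support M v;
         [/\ finitely_generated M, projective M
           & alg_isomorphic (endo M) F^o]])
  /\
  (forall M : rightModType (lpa F G), simple M /\ projective M ->
    ((exists! v : vertex G, sink v /\ module_support M v) /\
     ~ (exists C : set (vertex G), leak_class C /\ C `<=` module_support M))
    \/
    ((exists! C : set (vertex G), leak_class C /\ C `<=` module_support M) /\
     ~ (exists v : vertex G, sink v /\ module_support M v)))
  /\
  (exists Phi : (rightModType (lpa F G) -> Prop) -> vertex G + set (vertex G),
    one_to_one_on (@simple_projective_class F G) (@sinks_and_leak_classes G) Phi /\
    forall M : rightModType (lpa F G), simple M /\ projective M ->
      (forall v : vertex G, sink v ->
         (Phi (iso_class M) = inl v <-> module_support M v)) /\
      (forall C : set (vertex G), leak_class C ->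
         (Phi (iso_class M) = inr C <-> C `<=` module_support M))).

Proof.
split; first exact: simple_projective_equiv.
split.
  move=> M [sM pM]; have [x Mx] := supports_exists sM pM.
  have U y : supports M y -> x = y by apply: supports_uniq.
  case: x Mx U => [v|C] [H1 H2] U; [left|right]; split.
  - exists v; split=> // u Mu; have [//] : inl v = inl u := U (inl u) Mu.
  - by move=> [C MC]; have := U (inr C) MC.
  - exists C; split=> // D MD; have [//] : inr C = inr D := U (inr D) MD.
  - by move=> [v Mv]; have := U (inl v) Mv.
exists (@class_label F G); split; first exact: class_label_one_to_one.
move=> M [sM pM]; split=> [v sv|C cC]; rewrite class_labelP //=.
  by split=> [[]|].
by split=> [[]|].
Qed.
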